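(* Let $k\ge 2$, $r\ge 2$ and $n\ge 2r+1$ be integers. Then $$\mathrm{ex}_{\circlearrowright}(n,CP^r_k)=\begin{cases}\Theta(n^{r-1}) & \text{for } k\le 2r-1,\\[1mm] \displaystyle\binom{n}{r}-\binom{n-r}{r} & \text{for } k=r+1,\\[2mm] \Theta(n^{r-1}\log n) & \text{for } k\ge 2r.\end{cases}$$ (The case $k=r+1$ is included in the range $k\le 2r-1$, and there the exact value is given.)
   Context: A convex geometric $r$-graph is an $r$-uniform hypergraph whose vertex set is cyclically ordered. A convex geometric $r$-graph $H$ contains a convex geometric $r$-graph $F$ if there is an injection $V(F)\to V(H)$ preserving the cyclic ordering and mapping edges of $F$ to edges of $H$. $\mathrm{ex}_{\circlearrowright}(n,F)$ is the maximum number of edges in an $n$-vertex convex geometric $r$-graph that does not contain $F$. A tight $k$-path $v_0v_1\dots v_{k+r-2}$ is an $r$-graph on distinct vertices $v_0,\dots,v_{k+r-2}$ whose edges are $\{v_i,v_{i+1},\dots,v_{i+r-1}\}$ for $0\le i<k$. The $r$-uniform crossing $k$-path $CP^r_k$ is the tight $k$-path $v_0v_1\dots v_{r+k-2}$ with vertex ordering satisfying: (i) $v_0<v_1<\dots<v_{r-1}$; (ii) $v_j<v_{j+r}<v_{j+2r}<\cdots<v_{j+1}$ for each $0\le j<r-1$; (iii) $v_{r-1}<v_{2r-1}<v_{3r-1}<\cdots$ (only indices at most $r+k-2$ occur). In the convex geometric setting $<$ is the cyclic ordering, i.e. the vertices appear in clockwise cyclic order as $v_0,v_r,v_{2r},\dots,v_1,v_{r+1},v_{2r+1},\dots,\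 \dots,\ v_{r-1},v_{2r-1},v_{3r-1},\dots$, and then back to $v_0$. The $\Theta$ notation is as $n\to\infty$ with $k,r$ fixed. *)

(* Defs.v *)
From mathcomp Require Import all_boot.

Set Implicit Arguments.
Unset Strict Implicit.
Unset Printing Implicit Defensive.

(* [c x y z]: going clockwise from [x], one meets [y] strictly before [z];
   in particular [x], [y], [z] are distinct. *)
Definition cyclic_order (V : eqType) (c : V -> V -> V -> bool) : Prop :=
  [/\ forall x y z, c x y z -> c y z x,
      forall x y z, c x y z -> ~~ c x z y,
      forall x y z w, c x y z -> c x z w -> c x y w
    & forall x y z, uniq [:: x; y; z] -> c x y z || c x z y].

(* The cyclic order obtained by closing a strict linear order into a circle. *)
Definition cyclic_of (V : Type) (lt : rel V) (x y z : V) : bool :=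
  [|| lt x y && lt y z, lt y z && lt z x | lt z x && lt x y].

Definition strict_total (V : eqType) (lt : rel V) : Prop :=
  [/\ irreflexive lt, transitive lt & forall x y, x != y -> lt x y || lt y x].

Lemma cyclic_of_order (V : eqType) (lt : rel V) :
  strict_total lt -> cyclic_order (cyclic_of lt).
Proof.
case=> irr tr tot.
have asym x y : lt x y -> lt y x -> False.
  by move=> xy yx; move: (tr _ _ _ xy yx); rewrite irr.
split; rewrite /cyclic_of.
- by move=> x y z /or3P[] ->; rewrite ?orbT.
- move=> x y z /or3P[] /andP[h1 h2]; apply/negP => /or3P[] /andP[h3 h4];
  by [case: (asym _ _ h1 h3) | case: (asym _ _ h1 h4)
     | case: (asym _ _ h2 h3) | case: (asym _ _ h2 h4)].
- move=> x y z w /or3P[] /andP[h1 h2] /or3P[] /andP[h3 h4];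
  have h12 := tr _ _ _ h1 h2; have h34 := tr _ _ _ h3 h4;
  first [ by case: (asym _ _ h1 h3) | by case: (asym _ _ h1 h4)
        | by case: (asym _ _ h2 h3) | by case: (asym _ _ h2 h4)
        | by case: (asym _ _ h12 h3) | by case: (asym _ _ h12 h4)
        | by case: (asym _ _ h34 h1) | by case: (asym _ _ h34 h2)
        | by rewrite ?h1 ?h2 ?h3 ?h4 ?(tr _ _ _ h1 h3) ?(tr _ _ _ h2 h3)
             ?(tr _ _ _ h2 h4) ?(tr _ _ _ h1 h4) ?orbT
        | idtac ].
- move=> x y z /=; rewrite !inE negb_or andbT => /andP[/andP[xy xz] yz].
  by case/orP: (tot _ _ xy) => h1; case/orP: (tot _ _ xz) => h2;
     case/orP: (tot _ _ yz) => h3; rewrite h1 h2 h3 ?orbT.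
Qed.

(* Convex geometric r-graphs: r-uniform hypergraphs on a finite cyclically
   ordered vertex set. *)
Record cgh (r : nat) : Type := CGH {
  vtx : finType;
  cyc : vtx -> vtx -> vtx -> bool;
  edges : {set {set vtx}};
  cycP : cyclic_order cyc;
  edges_uniform : forall e, e \in edges -> #|e| = r }.

Definition contains (r : nat) (H F : cgh r) : bool :=
  [exists f : {ffun vtx F -> vtx H},
    [&& injectiveb f,
        [forall x, forall y, forall z, cyc x y z ==> cyc (f x) (f y) (f z)]
      & [forall e in edges F, f @: e \in edges H]]].

Notation uniform_sets r n :=
  {E : {set {set 'I_n}} | [forall e in E, #|e| == r]}.

Definition ltord (n : nat) : rel 'I_n := fun i j => i < j.

Lemma ltord_strict_total n : strict_total (@ltord n).
Proof.
split=> [x | y x z | x y]; rewrite /ltord; first exact: ltnn.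
- exact: ltn_trans.
- by rewrite -neq_ltn.
Qed.

Lemma uniform_setsP r n (E : uniform_sets r n) e : e \in val E -> #|e| = r.
Proof. by move: e; case: E => E /= /forall_inP HE e /HE /eqP. Qed.

(* The convex geometric r-graph with edge set [E] on the vertices
   0, 1, ..., n - 1 listed clockwise. *)
Definition clockwise_cgh (r n : nat) (E : uniform_sets r n) : cgh r :=
  CGH (cyclic_of_order (ltord_strict_total n)) (@uniform_setsP r n E).

(* It is enough to range over edge sets on the clockwise-ordered 'I_n, because
   all cyclic orders on n points are isomorphic: see [ex_cyc_ub] and
   [ex_cyc_attained] below. *)
Definition ex_cyc (r n : nat) (F : cgh r) : nat :=
  \max_(E : uniform_sets r n | ~~ contains (clockwise_cgh E) F) #|val E|.

(* Linear order in which the vertices of the crossing path are met clockwise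
   from v_0:  v_0, v_r, v_2r, ..., v_1, v_(r+1), ..., v_(r-1), v_(2r-1), ...
   where the ordinal i stands for v_i. *)
Definition crossing_lt (r m : nat) : rel 'I_m :=
  fun i j => (i %% r < j %% r) || (i %% r == j %% r) && (i < j).

Lemma crossing_lt_strict_total r m : strict_total (@crossing_lt r m).
Proof.
rewrite /crossing_lt; split=> [x | y x z | x y].
- by rewrite !ltnn andbF.
- case/orP=> [h1 | /andP[/eqP-> h1]] /orP[h2 | /andP[/eqP<- h2]].
  + by rewrite (ltn_trans h1 h2).
  + by rewrite h1.
  + by rewrite h2.
  + by rewrite eqxx (ltn_trans h1 h2) orbT.
- rewrite -val_eqE neq_ltn; case: (ltngtP (x %% r) (y %% r)) => //=.
Qed.

Definition tight_path_edges (r k : nat) : {set {set 'I_(k + r - 1)}} :=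
  [set [set j : 'I_(k + r - 1) | i <= j < i + r] | i : 'I_k].

Lemma tight_path_uniform r k e : e \in tight_path_edges r k -> #|e| = r.
Proof.
case/imsetP=> i _ ->.
have le_i : i + r <= k + r - 1.
  have k0 : 0 < k := leq_ltn_trans (leq0n i) (ltn_ord i).
  by rewrite -addnBAC // leq_add2r subn1 -ltnS prednK.
have lt_i (t : 'I_r) : i + t < k + r - 1.
  by apply: leq_trans le_i; rewrite ltn_add2l.
pose f t : 'I_(k + r - 1) := Ordinal (lt_i t).
have f_inj : injective f by move=> s t [/addnI/val_inj].
rewrite -[RHS]card_ord -(card_imset _ f_inj); congr #|pred_of_set _|.
apply/setP=> j; rewrite inE; apply/andP/imsetP => [[ij ji] | [t _ ->]].
  have lt_j : j - i < r by rewrite ltn_subLR.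
  by exists (Ordinal lt_j) => //; apply: val_inj; rewrite /= subnKC.
by rewrite /= leq_addr ltn_add2l.
Qed.

Definition crossing_path (r k : nat) : cgh r :=
  CGH (cyclic_of_order (crossing_lt_strict_total r (k + r - 1)))
      (@tight_path_uniform r k).

Lemma ex_cyc_attained r n (F : cgh r) :
  0 < #|edges F| ->
  exists2 E : uniform_sets r n, ~~ contains (clockwise_cgh E) F
    & #|val E| = ex_cyc n F.
Proof.
case/card_gt0P=> e eF; rewrite /ex_cyc.
have H0 : [forall e in (set0 : {set {set 'I_n}}), #|e| == r].
  by apply/forall_inP => e'; rewrite inE.
pose E0 : uniform_sets r n := exist _ set0 H0.
have N0 : ~~ contains (clockwise_cgh E0) F.
  apply/existsPn => f; apply/negP => /and3P[_ _ /forall_inP/(_ _ eF)].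
  by rewrite inE.
pose P (E : uniform_sets r n) := ~~ contains (clockwise_cgh E) F.
have P0 : 0 < #|P| by apply/card_gt0P; exists E0.
have [E NE ->] := eq_bigmax_cond (fun E : uniform_sets r n => #|val E|) P0.
by exists E.
Qed.

Lemma cyclic_order_linearize (V : finType) (c : V -> V -> V -> bool) :
  cyclic_order c ->
  exists2 f : V -> 'I_#|V|, injective f
    & forall x y z, c x y z = cyclic_of (@ltord #|V|) (f x) (f y) (f z).
Proof.
case=> rot asym tr tot.
have neq x y z : c x y z -> [/\ x != y, y != z & x != z].
  have n1 a b d : c a b d -> b != d.
    by move=> h; apply: contraTneq (h) => E; move: (asym _ _ _ h); rewrite E.
  move=> h; have h' := rot _ _ _ h; have h'' := rot _ _ _ h'.
  by split; [apply: (n1 _ _ _ h'') | apply: (n1 _ _ _ h) | rewrite eq_sym (n1 _ _ _ h')].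
case: (pickP V) => [x0 _ | V0]; last first.
  by exists (fun x => False_rect _ (notF (esym (V0 x)))) => x; have := V0 x.
pose lt y z := (y == x0) && (z != x0) || c x0 y z.
have ltST : strict_total lt.
  split.
  - move=> x; rewrite /lt andbN /=; apply/negP => /neq[_]; by rewrite eqxx.
  - move=> y x z /orP[/andP[/eqP-> y0] | h1] /orP[/andP[y0' z0] | h2].
    + by rewrite y0' in y0.
    + by case: (neq _ _ _ h2) => _ _; rewrite /lt eqxx eq_sym => ->.
    + by case: (neq _ _ _ h1) => _ _; rewrite eq_sym y0'.
    + by rewrite /lt (tr _ _ _ _ h1 h2) orbT.
  - move=> x y xy; rewrite /lt; case: (eqVneq x x0) => [E | x0x] /=.
      by rewrite eq_sym -E xy.
    case: (eqVneq y x0) => [E | y0] /=; first by rewrite orbT.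
    by apply: tot; rewrite /= !inE negb_or !(eq_sym x0) x0x y0 xy.
have cE x y z : c x y z = cyclic_of lt x y z.
  have imp a b d : cyclic_of lt a b d -> c a b d.
    have sub a' b' d' : lt a' b' -> lt b' d' -> c a' b' d'.
      case/orP=> [/andP[/eqP-> b0] | h1] /orP[/andP[/eqP E d0] | h2] //.
      - by rewrite E eqxx in b0.
      - by case: (neq _ _ _ h1) => _ _; rewrite E eqxx.
      - have h3 : c b' d' a' :=
          tr _ _ _ _ (rot _ _ _ h2) (rot _ _ _ (rot _ _ _ h1)).
        exact: rot _ _ _ (rot _ _ _ h3).
    case/or3P=> /andP[h1 h2]; first exact: sub h1 h2.
    - exact: rot _ _ _ (rot _ _ _ (sub _ _ _ h1 h2)).
    - exact: rot _ _ _ (sub _ _ _ h1 h2).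
  apply/idP/idP; last exact: imp.
  move=> h; have [xy yz xz] := neq _ _ _ h.
  have [_ _ _ tot'] := cyclic_of_order ltST.
  have /orP[//|/imp h'] : cyclic_of lt x y z || cyclic_of lt x z y.
    by apply: tot'; rewrite /= !inE negb_or xy xz yz.
  by move: (asym _ _ _ h); rewrite h'.
have [irr ltr ltot] := ltST.
have rkP y : #|[set z | lt z y]| < #|V|.
  rewrite -cardsT; apply: proper_card; apply/properP; split; first exact: subsetT.
  by exists y; rewrite inE // irr.
pose f y := Ordinal (rkP y).
have fmono y z : lt y z -> f y < f z.
  move=> yz; apply: proper_card; apply/properP; split.
    by apply/subsetP => u; rewrite !inE => uy; apply: ltr uy yz.
  by exists y; rewrite inE // irr.
have fE y z : ltord (f y) (f z) = lt y z.
  rewrite /ltord; apply/idP/idP; last exact: fmono.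
  move=> h; case: (eqVneq y z) => [E | /ltot/orP[//|/fmono h']].
    by rewrite E ltnn in h.
  by move: (ltn_trans h h'); rewrite ltnn.
exists f.
- move=> y z E; apply/eqP/negPn/negP => /ltot/orP[] /fmono; by rewrite E ltnn.
- by move=> x y z; rewrite cE /cyclic_of !fE.
Qed.

Lemma ex_cyc_ub r (F H : cgh r) :
  ~~ contains H F -> #|edges H| <= ex_cyc #|vtx H| F.
Proof.
move=> NH; have [f finj fc] := cyclic_order_linearize (cycP H).
have imf_inj : injective (fun e : {set vtx H} => f @: e) by exact: imset_inj.
pose E := [set f @: (e : {set vtx H}) | e : {set vtx H} in edges H].
have EU : [forall e in E, #|e| == r].
  apply/forall_inP => _ /imsetP[e eH ->].
  by rewrite card_imset // (edges_uniform eH).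
pose E' : uniform_sets r #|vtx H| := exist _ E EU.
have <- : #|val E'| = #|edges H| by rewrite card_imset.
apply: (@leq_bigmax_cond _ _ (fun E : uniform_sets r #|vtx H| => #|val E|)).
apply: contra NH => /existsP[g /and3P[/injectiveP ginj gc gE]].
have fbij : bijective f by apply: inj_card_bij; rewrite ?card_ord.
case: fbij => h fK hK.
apply/existsP; exists [ffun x => h (g x)]; apply/and3P; split.
- apply/injectiveP => x y; rewrite !ffunE => /(can_inj hK); exact: ginj.
- apply/'forall_'forall_forallP => x y z; rewrite !ffunE fc !hK.
  by move/forallP/(_ x)/forallP/(_ y)/forallP/(_ z): gc.
- apply/forall_inP => e eF; move/forall_inP/(_ _ eF): gE => /imsetP[e' e'H E1].
  rewrite (_ : _ @: e = e') //; apply: (imset_inj finj).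
  rewrite -E1 -imset_comp; apply: eq_imset => x /=; by rewrite ffunE hK.
Qed.

(* Main.v *)
Require Import Defs.
From mathcomp Require Import all_boot all_order all_algebra.
From mathcomp Require Import all_classical all_reals all_analysis.
From mathcomp Require Import fintype finset zify.
Set Implicit Arguments.
Unset Strict Implicit.
Unset Printing Implicit Defensive.

(* The crossing k-path grows by moves: from an r-set x_0 < ... < x_(r-1), raise
   the coordinates one at a time in cyclic order, k - 1 times in all, keeping
   all positions taken by a coordinate before all those taken by the next one.
   A family of r-sets admitting no such chain of moves is a union of k - 1
   subfamilies A_j inside which no j-th move is possible, and on each line in the
   direction of the moved coordinate A_j has few points.

   To keep the coordinates apart, a move must preserve, for each gap of length d
   in [2^l, 2^(l+1)), the last multiple of 2^l up to its right end.  With the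
   other coordinates fixed, the two separators around the moved coordinate take
   O(log n) values, whence O(n^(r-1) log n).  For k <= 2r - 1 the gap between the
   coordinates moved last in the first round needs no separator; rotating so that
   it is the smallest gap, of length d, leaves only scales from d on, and there
   are O(n^(r-1)) pairs of (r-1)-set and scale 2^l >= d.  For k = r + 1 no
   separator is needed at all and the loss at each step can be computed exactly.

   For the lower bounds one takes all r-sets with a given sum modulo n (k = 2),
   all r-sets containing n - 1 or two consecutive vertices (k = r + 1), and all
   r-sets whose two smallest elements differ by a power of 2 (k = 2r). *)

(** * Chains of moves and increasing functions *)

Section Reach.
Variable T : finType.
Implicit Types (D A : {set T}) (M : nat -> rel T).

(** The starting point x is itself required to lie in [G], so that each round removes from [G] a set
    inside which the move [M 0] never occurs. *)
Fixpoint reach D m M : {set T} :=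
  if m is m'.+1 then
    let G := reach D m' (fun j => M j.+1) in
    [set x in G | [exists y in G, M 0 x y]]
  else D.

Lemma reach_chain D m M x :
  x \in reach D m M ->
  exists X : nat -> T, [/\ X 0 = x, forall t, t <= m -> X t \in D
    & forall t, t < m -> M t (X t) (X t.+1)].
Proof.
elim: m M x => [|m IHm] M x /=.
  by move=> xD; exists (fun=> x); split=> // t; rewrite leqn0 => /eqP->.
rewrite inE => /andP[xG /exists_inP[y yG Mxy]].
have [X [X0 XD _]] := IHm _ _ xG; have [Y [Y0 YD YM]] := IHm _ _ yG.
exists (fun t => if t is t'.+1 then Y t' else x); split=> // -[|t] //=.
- by move=> _; rewrite -X0 XD.
- exact: YD.
- by rewrite Y0.
- exact: YM.
Qed.

Lemma reach_sub D m M : reach D m M \subset D.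
Proof.
apply/subsetP => x /reach_chain[X [<- XD _]]; exact: XD.
Qed.

(** Each round drops exactly the points of [G] with no move into [G]; these form an independent
    subset of [D], so the hypothesis bounds every loss. *)
Lemma card_reach D m M (L : nat -> nat) :
  (forall j A, j < m -> A \subset D -> {in A &, forall x y, ~~ M j x y} ->
     #|A| <= L j) ->
  #|D| <= #|reach D m M| + \sum_(j < m) L j.
Proof.
elim: m M L => [|m IHm] M L indep /=; first by rewrite big_ord0 addn0.
set M' := fun j => M j.+1; set G := reach D m M'.
apply: leq_trans (_ : #|G| + \sum_(j < m) L j.+1 <= _).
  by apply: (IHm M' (fun j => L j.+1)) => j A jm; apply: indep.
rewrite big_ord_recl addnA leq_add2r -(cardsID [set x | [exists y in G, M 0 x y]]).
apply: leq_add; first by apply/subset_leq_card/subsetP => x; rewrite !inE.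
apply: indep => //.
  exact: subset_trans (subsetDl _ _) (reach_sub _ _ _).
move=> x y; rewrite !inE => /andP[nx _] /andP[_ yG].
by apply: contra nx => Mxy; apply/exists_inP; exists y.
Qed.

End Reach.

Section Increasing.
Variables r n : nat.
Implicit Types (x y : {ffun 'I_r -> 'I_n}) (E : {set {set 'I_n}}).

(* The value [n] past the last coordinate makes the last gap behave like the
   others in the increasing condition. *)
Definition co x (c : nat) : nat := if insub c is Some i then val (x i) else n.

Lemma coE x (i : 'I_r) : co x i = x i.
Proof. by rewrite /co valK. Qed.

Lemma co_last x : co x r = n.
Proof. by rewrite /co insubF ?ltnn. Qed.

Lemma co_lt_n x c : c < r -> co x c < n.
Proof. by move=> cr; rewrite /co insubT /=. Qed.

Lemma co_inj x y : (forall c, c < r -> co x c = co y c) -> x = y.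
Proof.
by move=> xy; apply/ffunP => i; apply: val_inj; rewrite /= -!coE; apply: xy.
Qed.

Definition incr x := [forall i : 'I_r, co x i < co x i.+1].

Lemma incrP x : reflect (forall c, c < r -> co x c < co x c.+1) (incr x).
Proof.
apply: (iffP forallP) => [h c cr | h i]; last exact: h.
exact: (h (Ordinal cr)).
Qed.

Lemma incr_lt x i j : incr x -> i < j -> j <= r -> co x i < co x j.
Proof.
move=> /incrP xi; elim: j => // j IHj; rewrite ltnS leq_eqVlt => /orP[/eqP->|ij] jr.
  exact: xi.
by apply: ltn_trans (IHj ij (ltnW jr)) (xi _ jr).
Qed.

Lemma incr_le x i j : incr x -> i <= j -> j <= r -> co x i <= co x j.
Proof.
move=> xi; rewrite leq_eqVlt => /orP[/eqP->//|ij] jr; exact/ltnW/incr_lt.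
Qed.

Lemma incr_inj x : incr x -> injective x.
Proof.
move=> xi i j /(congr1 val); rewrite /= -!coE => eij; apply: val_inj => /=.
case: (ltngtP i j) => // ij.
- by have := incr_lt xi ij (ltnW (ltn_ord j)); rewrite eij ltnn.
- by have := incr_lt xi ij (ltnW (ltn_ord i)); rewrite eij ltnn.
Qed.

Definition edge x : {set 'I_n} := [set x i | i : 'I_r].

Lemma card_edge x : incr x -> #|edge x| = r.
Proof. by move=> xi; rewrite card_imset ?card_ord //; apply: incr_inj. Qed.


(** At the first index c where the two sequences differ, the smaller value would have to occur in
    the other one; there the entries before c are too small and those from c on too large. *)
Lemma edge_inj : {in incr &, injective edge}.
Proof.
have lt_absurd x y c : incr x -> incr y -> edge x = edge y -> c < r ->
    (forall d, d < c -> co x d = co y d) -> co x c < co y c -> False.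
  move=> xi yi Exy cr eq_lt lt_c.
  have : x (Ordinal cr) \in edge y by rewrite -Exy imset_f.
  case/imsetP=> j _ /(congr1 val); rewrite /= -!coE /= => Ej.
  case: (ltnP j c) => jc.
    by have := incr_lt xi jc (ltnW cr); rewrite (eq_lt _ jc) Ej ltnn.
  by have := incr_le yi jc (ltnW (ltn_ord j)); rewrite -Ej leqNgt lt_c.
move=> x y xi yi Exy; apply: co_inj; elim/ltn_ind => c IHc cr.
have IH d : d < c -> co x d = co y d.
  by move=> dc; apply: IHc dc (ltn_trans dc cr).
case: (ltngtP (co x c) (co y c)) => // h.
- by case: (lt_absurd x y c).
- by case: (lt_absurd y x c) => // d /IH.
Qed.

Lemma edge_surj (e : {set 'I_n}) : #|e| = r -> exists2 x, incr x & edge x = e.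
Proof.
move=> er.
have lt_e (i : 'I_r) : i < #|e| by rewrite er.
pose x : {ffun 'I_r -> 'I_n} := [ffun i => enum_val (Ordinal (lt_e i))].
exists x.
  apply/forallP => i; rewrite coE.
  case: (ltnP i.+1 r) => [ir|]; last first.
    move=> ri; have -> : i.+1 = r by apply/eqP; rewrite eqn_leq ri ltn_ord.
    by rewrite co_last.
  rewrite -[i.+1]/(val (Ordinal ir)) coE !ffunE /enum_val /=.
  have sorted_e : sorted (relpre val ltn) (enum e).
    rewrite -sorted_map -[enum _](eq_filter (mem_enum _)).
    rewrite -(eq_filter (mem_map val_inj _)) -filter_map.
    by rewrite (sorted_filter ltn_trans) // unlock val_ord_enum iota_ltn_sorted.
  have tr_e : transitive (relpre (val : 'I_n -> nat) ltn).
    by move=> a b c; apply: ltn_trans.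
  rewrite (set_nth_default (enum_default (Ordinal (lt_e (Ordinal ir))))).
    by apply: (sorted_ltn_nth tr_e); rewrite // inE -cardE er.
  by rewrite -cardE er.
apply/setP => v; apply/imsetP/idP => [[i _ ->]|ve].
  by rewrite ffunE enum_valP.
have ri : enum_rank_in ve v < r by rewrite -[X in _ < X]er.
exists (Ordinal ri) => //; rewrite ffunE /=.
by rewrite (_ : Ordinal _ = enum_rank_in ve v) ?enum_rankK_in //; apply: val_inj.
Qed.

Definition paths_of E : {set {ffun 'I_r -> 'I_n}} :=
  [set x | incr x & edge x \in E].

Lemma card_paths_of E : (forall e, e \in E -> #|e| = r) -> #|paths_of E| = #|E|.
Proof.
move=> Er; have im : edge @: paths_of E = E.
  apply/setP=> e; apply/imsetP/idP => [[x + ->]|eE].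
    by rewrite inE => /andP[].
  have [x xi xe] := edge_surj (Er e eE).
  by exists x; rewrite // inE xe eE andbT.
rewrite -[in RHS]im card_in_imset // => x y; rewrite !inE.
by move=> /andP[xi _] /andP[yi _]; apply: edge_inj.
Qed.

Lemma card_incr : #|[set x | incr x]| = 'C(n, r).
Proof.
rewrite -[X in 'C(X, _)]card_ord -card_draws -card_paths_of.
  apply: eq_card => x; rewrite !inE; case xi: (incr x) => //=.
  by rewrite card_edge ?eqxx.
by move=> e; rewrite inE => /eqP.
Qed.

Definition agree_off c x y := [forall i : 'I_r, (val i != c) ==> (x i == y i)].

Lemma agree_offP c x y :
  reflect (forall i, i < r -> i != c -> co x i = co y i) (agree_off c x y).
Proof.
apply: (iffP forallP) => [h i ir ic | h i].
  have /implyP/(_ ic)/eqP := h (Ordinal ir).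
  by rewrite -[i]/(val (Ordinal ir)) !coE => ->.
by apply/implyP => ic; rewrite -val_eqE /= -!coE h.
Qed.

Lemma agree_off_co c x y i : agree_off c x y -> i != c -> co x i = co y i.
Proof.
move=> /agree_offP h ic; case: (ltnP i r) => [ir|ri]; first exact: h.
by rewrite /co insubF // ltnNge ri.
Qed.

Definition raises c x y := (co x c < co y c) && agree_off c x y.

Lemma raises_chain_leq (C : nat -> nat) (X : nat -> {ffun 'I_r -> 'I_n}) m :
  (forall t, t < m -> raises (C t) (X t) (X t.+1)) ->
  forall c t t', t <= t' -> t' <= m -> co (X t) c <= co (X t') c.
Proof.
move=> XC c t; elim=> [|t' IH]; first by rewrite leqn0 => /eqP->.
rewrite leq_eqVlt => /orP[/eqP->//|tt'] t'm; apply: leq_trans (IH tt' (ltnW t'm)) _.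
have /andP[lt_co off] := XC _ t'm.
by case: (eqVneq c (C t')) => [->|cC]; [apply: ltnW | rewrite (agree_off_co off)].
Qed.

Lemma raises_chain_const (C : nat -> nat) (X : nat -> {ffun 'I_r -> 'I_n}) m :
  (forall t, t < m -> raises (C t) (X t) (X t.+1)) ->
  forall c t t', t <= t' -> t' <= m ->
    (forall u, t <= u < t' -> C u != c) -> co (X t) c = co (X t') c.
Proof.
move=> XC c t; elim=> [|t' IH]; first by rewrite leqn0 => /eqP->.
rewrite leq_eqVlt => /orP[/eqP->//|tt'] t'm Cc; rewrite IH ?(ltnW t'm) //.
  have /andP[_ off] := XC _ t'm; apply: agree_off_co off _.
  by rewrite eq_sym; apply: Cc; lia.
by move=> u /andP[tu ut']; apply: Cc; rewrite tu ltnW.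
Qed.

End Increasing.

(** * Chains give crossing paths *)

Lemma modnD_small r s i : s < r ->
  (s + i) %% r = if i %% r + s < r then i %% r + s else i %% r + s - r.
Proof.
move=> sr; rewrite -modnDmr; have := ltn_pmod i (leq_ltn_trans (leq0n s) sr).
move: (i %% r) => a ar; rewrite addnC; case: ltnP => h; first by rewrite modn_small.
by rewrite -{1}(subnK h) modnDr modn_small //; lia.
Qed.

Lemma modn_window r i j : i < j -> j < i + r -> i %% r != j %% r.
Proof.
move=> ij jr; rewrite eq_sym eqn_mod_dvd 1?ltnW // gtnNdvd ?subn_gt0 //; lia.
Qed.

(** Placing an upper set of a linear order in front of the rest cuts the same circle at another
    point. *)
Lemma cyclic_of_cut (V : Type) (lt : rel V) (P : pred V) x y z :
  (forall x y, lt x y -> P x -> P y) -> cyclic_of lt x y z ->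
  cyclic_of (fun x y => P x && ~~ P y || (P x == P y) && lt x y) x y z.
Proof.
move=> up; rewrite /cyclic_of.
move: (up x y) (up y z) (up z x).
case: (lt x y); case: (lt y z); case: (lt z x); case: (P x); case: (P y);
  case: (P z) => //= h1 h2 h3.
all: by [have := h1 isT isT | have := h2 isT isT | have := h3 isT isT].
Qed.

(** The shift s lets the path start in any coordinate: [v i] belongs to coordinate s + i modulo r.
    The positions then cut the circle of the path not at v_0 but before the classes with i %% r + s
    >= r, which wrap around to the lowest coordinates. *)
Lemma crossing_path_contained r n k s (E : uniform_sets r n) (v : nat -> 'I_n) :
  s < r ->
  (forall i j, i < k + r - 1 -> j < k + r - 1 -> (s + i) %% r < (s + j) %% r ->
     v i < v j) ->
  (forall i j, i < j -> j < k + r - 1 -> (s + i) %% r = (s + j) %% r ->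
     v i < v j) ->
  (forall i, i < k ->
     exists2 e, e \in val E & forall j, i <= j < i + r -> v j \in e) ->
  contains (clockwise_cgh E) (crossing_path r k).
Proof.
move=> sr v_lt v_eq vE.
have v_inj (i j : 'I_(k + r - 1)) : v i = v j -> i = j.
  move=> vij; apply: val_inj => /=.
  case: (ltngtP ((s + i) %% r) ((s + j) %% r)) => h.
  - by have := v_lt _ _ (ltn_ord i) (ltn_ord j) h; rewrite vij ltnn.
  - by have := v_lt _ _ (ltn_ord j) (ltn_ord i) h; rewrite vij ltnn.
  case: (ltngtP i j) => // ij.
  - by have := v_eq _ _ ij (ltn_ord j) h; rewrite vij ltnn.
  - by have := v_eq _ _ ij (ltn_ord i) (esym h); rewrite vij ltnn.
apply/existsP; exists [ffun j : 'I_(k + r - 1) => v j]; apply/and3P; split.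
- by apply/injectiveP => i j; rewrite !ffunE; apply: v_inj.
- apply/'forall_'forall_forallP => x y z; rewrite !ffunE; apply/implyP.
  have lt_v (i j : 'I_(k + r - 1)) :
      (r <= i %% r + s) && ~~ (r <= j %% r + s) ||
      ((r <= i %% r + s) == (r <= j %% r + s)) && crossing_lt r i j ->
      ltord (v i) (v j).
    have r0 : 0 < r by lia.
    have ir := ltn_pmod i r0; have jr := ltn_pmod j r0.
    case/orP=> [/andP[hi hj] | /andP[/eqP hij /orP[ij|/andP[/eqP Eij ij]]]].
    - apply: v_lt; rewrite // !modnD_small //.
      rewrite (ltnNge (i %% r + s)) hi (ltnNge (j %% r + s)) hj /=; lia.
    - apply: v_lt; rewrite // !modnD_small //; move: hij.
      by case: (ltnP (i %% r + s) r) => ?; case: (ltnP (j %% r + s) r) => ? //= _; lia.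
    - by apply: v_eq; rewrite // !modnD_small // Eij.
  have cut_up i j : @crossing_lt r (k + r - 1) i j ->
      r <= i %% r + s -> r <= j %% r + s.
    by case/orP=> [h | /andP[/eqP->//]]; lia.
  move=> /(cyclic_of_cut cut_up); rewrite /= /cyclic_of.
  by move=> /or3P[] /andP[/lt_v-> /lt_v->]; rewrite ?orbT.
- apply/forall_inP => e' e'P; have [i _ E'] := imsetP e'P.
  have [e eE ve] := vE _ (ltn_ord i).
  rewrite (_ : _ @: _ = e) //; apply/eqP; rewrite eqEcard; apply/andP; split.
    apply/subsetP => _ /imsetP[j + ->]; rewrite E' inE ffunE; exact: ve.
  rewrite (uniform_setsP eE) card_in_imset ?(tight_path_uniform e'P) //.
  by move=> a b _ _; rewrite !ffunE; apply: v_inj.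
Qed.

Lemma chain_contains r n k s (E : uniform_sets r n)
    (X : nat -> {ffun 'I_r -> 'I_n}) :
  0 < k -> s < r ->
  (forall t, t < k -> X t \in paths_of r (val E)) ->
  (forall t, t.+1 < k -> raises ((s + t) %% r) (X t) (X t.+1)) ->
  (forall c c' t t', c < c' -> c' < r -> t < k -> t' < k ->
     co (X t) c < co (X t') c') ->
  contains (clockwise_cgh E) (crossing_path r k).
Proof.
move=> k0 sr XE Xraise Xblock.
have Xr t : t < k.-1 -> raises ((s + t) %% r) (X t) (X t.+1).
  by move=> tk; apply: Xraise; lia.
have mono := raises_chain_leq Xr; have const := raises_chain_const Xr.
have r0 : 0 < r by lia.
have modr i : (s + i) %% r < r by apply: ltn_pmod.
(* The truncated time i + 1 - r is 0 for the first r vertices, which form [X 0]; a later v_i is the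
   value created by move i - r. A coordinate rests for r - 1 moves after being raised, so [X j]
   consists of v_j, ..., v_(j+r-1). *)
pose v i := X (i.+1 - r) (Ordinal (modr i)).
have vE i : v i = co (X (i.+1 - r)) ((s + i) %% r) :> nat.
  by rewrite -[(s + i) %% r]/(val (Ordinal (modr i))) coE.
have window i j : j < k -> j <= i < j + r -> v i = co (X j) ((s + i) %% r) :> nat.
  move=> jk /andP[ji ijr]; rewrite vE; apply: const; [lia | lia |] => u uj.
  rewrite eqn_modDl modn_window //; lia.
apply: (crossing_path_contained sr (v := v)).
- by move=> i j ik jk h; rewrite !vE; apply: Xblock => //; lia.
- move=> i j ij jk h; rewrite !vE h.
  have rj : i + r <= j.
    rewrite leqNgt; apply/negP => jr; have := modn_window ij jr.
    by rewrite -(eqn_modDl s) h eqxx.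
  have Ej : (s + j) %% r = (s + (j - r)) %% r.
    by rewrite -[j in LHS](@subnK r) ?addnA ?modnDr //; lia.
  apply: leq_ltn_trans (_ : co (X (j - r)) ((s + j) %% r) < _).
    by apply: mono => //; lia.
  rewrite Ej (_ : j.+1 - r = (j - r).+1); last by lia.
  have /andP[] // : raises ((s + (j - r)) %% r) (X (j - r)) (X (j - r).+1).
  by apply: Xr; lia.
- move=> i ik; have := XE _ ik; rewrite inE => /andP[Xi XiE].
  exists (edge (X i)) => // j ij.
  apply/imsetP; exists (Ordinal (modr j)) => //; apply: val_inj => /=.
  by rewrite (window _ _ ik ij) -coE.
Qed.

Lemma contains_crossing_path_leq r k k' (H : cgh r) : k <= k' ->
  contains H (crossing_path r k') -> contains H (crossing_path r k).
Proof.
move=> kk' /existsP[f /and3P[/injectiveP f_inj /'forall_'forall_forallP fc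
  /forall_inP fE]].
have le_v : k + r - 1 <= k' + r - 1 by lia.
pose w := widen_ord le_v.
have w_inj : injective w by move=> i j /(congr1 val) ij; apply: val_inj.
apply/existsP; exists [ffun j : 'I_(k + r - 1) => f (w j)]; apply/and3P; split.
- by apply/injectiveP => i j; rewrite !ffunE => /f_inj/w_inj.
- apply/'forall_'forall_forallP => x y z; rewrite !ffunE.
  exact: fc (w x) (w y) (w z).
- apply/forall_inP => _ /imsetP[i _ ->].
  rewrite (_ : _ @: _ = f @: [set j : 'I_(k' + r - 1) | i <= j < i + r]).
    by apply: fE; apply/imsetP; exists (widen_ord kk' i).
  apply/setP => u; apply/imsetP/imsetP => [[j]|[j]].
    by rewrite inE ffunE => ij ->; exists (w j); rewrite ?inE.
  rewrite inE => ij ->; have jk : j < k + r - 1 by have := ltn_ord i; lia.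
  exists (Ordinal jk); rewrite ?inE ?ffunE //; congr (f _); exact: val_inj.
Qed.

Lemma ex_cyc_crossing_path_leq r n k k' : k <= k' ->
  ex_cyc n (crossing_path r k) <= ex_cyc n (crossing_path r k').
Proof.
move=> kk'; apply/bigmax_leqP => E NE.
apply: (@leq_bigmax_cond _ _ (fun E : uniform_sets r n => #|val E|)).
by apply: contra NE; apply: contains_crossing_path_leq.
Qed.

Lemma uniform_sets_leq_ex_cyc r n (F : cgh r) (E : {set {set 'I_n}}) :
  (forall e, e \in E -> #|e| = r) ->
  (forall E' : uniform_sets r n, val E' = E -> ~~ contains (clockwise_cgh E') F) ->
  #|E| <= ex_cyc n F.
Proof.
move=> Er NE; have EU : [forall e in E, #|e| == r].
  by apply/forall_inP => e /Er ->.
exact: (@leq_bigmax_cond _ _ (fun E : uniform_sets r n => #|val E|)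
  (exist _ E EU) (NE (exist _ E EU) erefl)).
Qed.

Lemma ex_cyc_leqP r n (F : cgh r) B :
  (forall E : uniform_sets r n, ~~ contains (clockwise_cgh E) F ->
     #|paths_of r (val E)| <= B) -> ex_cyc n F <= B.
Proof.
move=> h; apply/bigmax_leqP => E NE; rewrite -(card_paths_of (r := r)) ?h //.
exact: uniform_setsP.
Qed.

(** * The exact value for k = r + 1 *)

Section Moves.
Variables r n : nat.
Implicit Types (x y : {ffun 'I_r -> 'I_n}).

(* What [reach] leaves of the family of all r-sets when the moves to come are
   those of the coordinates j, ..., r - 1. *)
Definition spread j : {set {ffun 'I_r -> 'I_n}} :=
  [set x | incr x & [forall i : 'I_r, (j <= i) ==> (co x i + 1 < co x i.+1)]].

Lemma spreadP j x :
  reflect (forall c, c < r -> co x c + (j <= c) < co x c.+1) (x \in spread j).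
Proof.
rewrite inE; apply: (iffP andP) => [[/incrP xi /forallP h] c cr | h].
  case: (leqP j c) => jc /=; last by rewrite addn0 xi.
  by have /implyP := h (Ordinal cr); apply.
split; first by apply/incrP => c /h; lia.
by apply/forallP => i; apply/implyP => ji; have := h i (ltn_ord i); rewrite ji.
Qed.

Lemma spread_last : spread r = [set x | incr x].
Proof.
apply/setP => x; rewrite !inE andbC; case: forallP => // -[] i.
by rewrite leqNgt ltn_ord.
Qed.

Definition set_co x (c v : nat) : {ffun 'I_r -> 'I_n} :=
  [ffun i : 'I_r => if (i == c :> nat) then insubd (x i) v else x i].

Lemma co_set x (c v i : nat) : v < n -> c < r ->
  co (set_co x c v) i = if i == c then v else co x i.
Proof.
move=> vn cr; case: (ltnP i r) => [ir|ri]; last first.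
  rewrite /co !insubF ?ltnNge ?ri //; case: eqP => // E; lia.
rewrite -[i]/(val (Ordinal ir)) coE ffunE /=; case: eqP => // _.
  by rewrite val_insubd vn.
by rewrite -coE.
Qed.

Lemma agree_off_set x (c v : nat) : agree_off c x (set_co x c v).
Proof.
apply/forallP => i; apply/implyP => ic; by rewrite ffunE (negPf ic).
Qed.


(* On each line in direction j, passing to [spread j] removes exactly the last
   point, and passing to [reach] at most the last point. *)
Lemma card_spread_reach (D : {set {ffun 'I_r -> 'I_n}}) m j M :
  j + m = r -> (forall i, M i =2 raises (j + i)) ->
  #|spread j :\: reach D m M| <= #|spread r :\: D|.
Proof.
elim: m j M => [|m IHm] j M jm ME; first by have -> : j = r by lia.
have jr : j < r by lia.
apply: leq_trans (IHm j.+1 (fun i => M i.+1) _ _); last first.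
- by move=> i x y; rewrite ME addSnnS.
- by rewrite addSnnS.
rewrite /=; set G := reach _ _ _.
pose up x := [exists y in G, raises j x y].
have -> : [set x in G | [exists y in G, M 0 x y]] = [set x in G | up x].
  apply/setP => x; rewrite !inE; congr andb; apply: eq_existsb => y.
  by rewrite ME addn0.
pose phi x := if up x then x else set_co x j (co x j).+1.
have spread_up x : x \in spread j -> (co x j).+1 < n.
  move=> xj; have xi : incr x by move: xj; rewrite inE => /andP[].
  have := spreadP _ _ xj j jr; rewrite leqnn.
  by have := incr_le xi jr (leqnn r); rewrite co_last; lia.
have phi_in : phi @: (spread j :\: [set x in G | up x]) \subset spread j.+1 :\: G.
  apply/subsetP => _ /imsetP[x + ->]; rewrite in_setD inE => /andP[nG xj].
  rewrite in_setD /phi; case: ifP nG => [ux|nu _]; rewrite ?andbT.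
    move=> ->; apply/spreadP => c cr; have := spreadP _ _ xj c cr; lia.
  apply/andP; split.
    apply/negP => G'; suff: up x by rewrite nu.
    apply/exists_inP.
    exists (set_co x j (co x j).+1) => //; rewrite /raises agree_off_set andbT.
    by rewrite co_set ?eqxx ?spread_up.
  apply/spreadP => c cr; have := spreadP _ _ xj c cr; rewrite !co_set ?spread_up //.
  case: (eqVneq c j) => [->|cj]; first by case: eqP; lia.
  by case: (eqVneq c.+1 j) => [Ej|]; [rewrite Ej|]; lia.
apply: leq_trans (subset_leq_card phi_in).
rewrite card_in_imset // => x y; rewrite in_setD => /andP[_ xj].
rewrite in_setD => /andP[_ yj].
have up_pred z : z \in spread j -> up (set_co z j (co z j).+1) -> up z.
  move=> zj /exists_inP[w wG /andP[zw ow]]; apply/exists_inP; exists w => //.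
  rewrite co_set ?spread_up // eqxx in zw.
  apply/andP; split; first exact: ltn_trans zw.
  apply/agree_offP => i ir ic.
  by rewrite -(agree_off_co ow ic) co_set ?spread_up // (negPf ic).
rewrite /phi; case: ifP => ux; case: ifP => uy //.
- by move=> E; have := up_pred y yj; rewrite -E ux uy => /(_ isT).
- by move=> E; have := up_pred x xj; rewrite E uy ux => /(_ isT).
- move=> E; apply: co_inj => c cr; have := congr1 (fun z => co z c) E.
  by rewrite !co_set ?spread_up //; case: eqP => // -> [].
Qed.

End Moves.

(** Lowering coordinate c by c turns gaps of at least 2, the last one up to n included, into gaps of
    at least 1, and lowers the end n to n - r. *)
Lemma card_spread0 r n : #|spread r n 0| = 'C(n - r, r).
Proof.
have lt_n (y : {ffun 'I_r -> 'I_(n - r)}) (i : 'I_r) : y i + i < n.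
  by have := ltn_ord (y i); have := ltn_ord i; lia.
pose lo y : {ffun 'I_r -> 'I_n} := [ffun i => Ordinal (lt_n y i)].
have lo_co y c : c < r -> co (lo y) c = co y c + c.
  by move=> cr; rewrite -[c]/(val (Ordinal cr)) !coE ffunE.
rewrite -card_incr -(card_imset (f := lo)); last first.
  move=> x y E; apply: co_inj => c cr; apply/(@addIn c).
  by rewrite -!lo_co // E.
apply: eq_card => x; apply/idP/imsetP => [/spreadP x0 | [y + ->]].
  have gap c d : c + d <= r -> co x c + 2 * d <= co x (c + d).
    elim: d => [|d IH] cd; first by rewrite addn0; lia.
    by rewrite addnS; have := x0 (c + d); have := IH; lia.
  have lt_nr (i : 'I_r) : x i - i < n - r.
    have ir := ltn_ord i; have := gap i (r - i).
    rewrite subnKC ?(ltnW ir) // co_last coE => /(_ (leqnn _)).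
    have := gap 0 i (ltnW ir); rewrite !add0n coE.
    by move: (nat_of_ord (x i)) (nat_of_ord i) ir (co x 0); clear=> a b; lia.
  pose y : {ffun 'I_r -> 'I_(n - r)} := [ffun i => Ordinal (lt_nr i)].
  have yE c : c < r -> co y c = co x c - c /\ c <= co x c.
    move=> cr; have := gap 0 c; rewrite add0n.
    by rewrite -[c]/(val (Ordinal cr)) !coE ffunE /=; lia.
  exists y; last by apply: co_inj => c cr; rewrite lo_co //; have := yE c cr; lia.
  rewrite inE; apply/incrP => c cr; have [-> _] := yE c cr.
  case: (ltnP c.+1 r) => [c1r|]; last first.
    move=> rc; have -> : c.+1 = r by lia.
    rewrite co_last -[c]/(val (Ordinal cr)) coE; exact: lt_nr.
  have [-> _] := yE _ c1r; have := x0 c cr; have := yE c cr; have := yE _ c1r; lia.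
rewrite inE => /incrP yi; apply/spreadP => c cr; rewrite leq0n lo_co //.
case: (ltnP c.+1 r) => [c1r|rc]; first by rewrite lo_co //; have := yi c cr; lia.
have := co_lt_n y cr; have -> : c.+1 = r by lia.
rewrite co_last; lia.
Qed.

Lemma reach_contains r n (E : uniform_sets r n) : 0 < r ->
  ~~ contains (clockwise_cgh E) (crossing_path r (r + 1)) ->
  reach (paths_of r (val E)) r (@raises r n) = set0.
Proof.
move=> r0; apply: contraNeq => /set0Pn[x /reach_chain[X [_ XE Xr]]].
have mono := raises_chain_leq Xr; have const := raises_chain_const Xr.
apply: (chain_contains (s := 0) (X := X)) => //.
- lia.
- by move=> t tr; apply: XE; lia.
- by move=> t tr; rewrite modn_small; [apply: Xr|]; lia.
move=> c c' t t' cc' c'r tr t'r.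
(* At time c + 1 the coordinates up to c are final and the others initial. *)
have le_c : co (X t) c <= co (X c.+1) c.
  case: (leqP t c.+1) => tc; first by apply: mono; lia.
  by rewrite (const c c.+1 t) //; lia.
have ge_c' : co (X c.+1) c' <= co (X t') c'.
  case: (leqP c.+1 t') => tc; first by apply: mono; lia.
  by rewrite -(const c' t' c.+1) //; lia.
have := XE c.+1; rewrite inE => /(_ (leq_trans cc' (ltnW c'r)))/andP[Xi _].
have := incr_lt Xi cc' (ltnW c'r); lia.
Qed.

(** The witness a is the lower of two consecutive vertices of e, or the vertex n - 1. The second
    case fits the same formula because no b of ['I_n] has value n. *)
Lemma not_spread0P r n (e : {set 'I_n}) :
  e \in @edge r n @: (spread r n r :\: spread r n 0) ->
  exists2 a, a \in e & forall b : 'I_n, b = a.+1 :> nat -> b \in e.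
Proof.
case/imsetP=> x; rewrite inE => /andP[n0 xr ->].
have /existsP[i ni] : [exists i : 'I_r, co x i.+1 <= co x i + 1].
  move: n0; apply: contraR => /existsPn h; apply/spreadP => c cr.
  by have := h (Ordinal cr); rewrite -ltnNge.
have xi : incr x by move: xr; rewrite spread_last inE.
have xi1 := incrP _ xi i (ltn_ord i).
exists (x i); first exact: imset_f.
move=> b ba; case: (ltnP i.+1 r) => [ir|ri].
  apply/imsetP; exists (Ordinal ir) => //; apply: val_inj.
  have := coE x (Ordinal ir); have := coE x i; move: ni xi1 ba => /=; lia.
have E : i.+1 = r by have := ltn_ord i; lia.
move: ni (ltn_ord b); rewrite ba -coE E co_last addn1 ltnNge => ->.
by [].
Qed.

(** Two vertices of the first edge are never clockwise neighbours on the path: v_(i+r) directly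
    follows v_i. So the first edge must contain the vertex n - 1. The same holds for the last edge,
    where v_(l-r) directly precedes v_l. But these two edges are disjoint. *)
Lemma not_spread0_free r n (E : uniform_sets r n) : 0 < r ->
  val E = @edge r n @: (spread r n r :\: spread r n 0) ->
  ~~ contains (clockwise_cgh E) (crossing_path r (r + 1)).
Proof.
move=> r0 EE; apply/existsP => -[f /and3P[/injectiveP f_inj
  /'forall_'forall_forallP fc /forall_inP fE]].
have Er : r + 1 + r - 1 = 2 * r by lia.
have win s : s <= r -> exists2 a, a \in f @: [set j : 'I_(r + 1 + r - 1) | s <= j < s + r]
    & forall b : 'I_n, b = a.+1 :> nat ->
        b \in f @: [set j : 'I_(r + 1 + r - 1) | s <= j < s + r].
  move=> sr; apply: (@not_spread0P r); rewrite -EE; apply: fE.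
  have sr1 : s < r + 1 by lia.
  by apply/imsetP; exists (Ordinal sr1).
have no_between (i j l : 'I_(r + 1 + r - 1)) :
    f l = (f i).+1 :> nat -> cyc (c := crossing_path r (r + 1)) i j l -> False.
  move=> fl /(implyP (fc i j l)); rewrite /= /cyclic_of /ltord fl.
  by move: (nat_of_ord (f i)) (nat_of_ord (f j)) => a b; lia.
have modr (i : 'I_(r + 1 + r - 1)) : i %% r = if i < r then i : nat else i - r.
  have iE := ltn_ord i; case: ltnP => ir; first by rewrite modn_small.
  by rewrite -[in LHS](subnK ir) modnDr modn_small //; lia.
have [_ /imsetP[i ir ->] hi] := win 0 (leq0n r).
have [_ /imsetP[j jr ->] hj] := win r (leqnn r).
rewrite !inE in ir jr.
have fin : (f i).+1 = n.
  case: (ltngtP (f i).+1 n) => [fn||//]; last by have := ltn_ord (f i); lia.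
  have /imsetP[l lr fl] := hi (Ordinal fn) erefl; rewrite !inE in lr.
  have ir2 : i + r < r + 1 + r - 1 by lia.
  exfalso; apply: (no_between i (Ordinal ir2) l); first by rewrite -fl.
  have il : i <> l by move=> il; move: fl => /(congr1 val) /=; rewrite il; lia.
  have {}il : val i <> val l by move/val_inj.
  move: il (ir) (lr); rewrite /= /cyclic_of /crossing_lt !modr /=.
  move: (nat_of_ord i) (nat_of_ord l) => a b ab ar br.
  have -> : a < r by lia.
  have -> : b < r by lia.
  have -> : (a + r < r) = false by lia.
  by rewrite addnK; clear -ab ar br r0; lia.

have fjn : (f j).+1 = n.
  case: (ltngtP (f j).+1 n) => [fn||//]; last by have := ltn_ord (f j); lia.
  have /imsetP[l lr fl] := hj (Ordinal fn) erefl; rewrite !inE in lr.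
  have lr2 : l - r < r + 1 + r - 1 by lia.
  exfalso; apply: (no_between j (Ordinal lr2) l); first by rewrite -fl.
  have jl : val j <> val l.
    by move/val_inj=> jl; move: fl => /(congr1 val) /=; rewrite jl; lia.
  move: jl (jr) (lr); rewrite /= /cyclic_of /crossing_lt !modr /=.
  move: (nat_of_ord j) (nat_of_ord l) => a b ab ar br.
  have -> : (a < r) = false by lia.
  have -> : (b < r) = false by lia.
  have -> : b - r < r by lia.
  by clear -ab ar br r0; lia.
have /f_inj ij : f i = f j by apply/val_inj/succn_inj; exact: etrans fin (esym fjn).
by case/andP: ir => _; case/andP: jr => jr _; rewrite ij add0n ltnNge jr.
Qed.

Lemma ex_cyc_crossing_path_exact r n : 0 < r ->
  ex_cyc n (crossing_path r (r + 1)) = 'C(n, r) - 'C(n - r, r).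
Proof.
move=> r0; rewrite -card_spread0 -card_incr -spread_last.
have sub : spread r n 0 \subset spread r n r.
  by rewrite spread_last; apply/subsetP => x; rewrite !inE => /andP[].
apply/eqP; rewrite eqn_leq; apply/andP; split.
  apply: ex_cyc_leqP => E NE.
  (* As nothing is reached, the r-sets outside the family are at least as many as the elements of
     [spread r n 0]. *)
  have := @card_spread_reach r n (paths_of r (val E)) r 0 (@raises r n) (add0n _).
  rewrite reach_contains // setD0 => /(_ (fun i x y => erefl)).
  have /setIidPr subP : paths_of r (val E) \subset spread r n r.
    by rewrite spread_last; apply/subsetP => x; rewrite !inE => /andP[].
  rewrite cardsD subP => le_diff.
  have le_paths : #|paths_of r (val E)| <= #|spread r n r|.
    by rewrite -{1}subP subset_leq_card ?subsetIl.
  by rewrite -(subKn le_paths) leq_sub2l.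
have <- : #|spread r n r :\: spread r n 0| = #|spread r n r| - #|spread r n 0|.
  by rewrite cardsD (setIidPr sub).
rewrite -(@card_in_imset _ _ (@edge r n)).
  apply: uniform_sets_leq_ex_cyc => [e /imsetP[x + ->]|E' EE'].
    rewrite in_setD spread_last => /andP[_]; rewrite inE => xi.
    exact: card_edge.
  exact: not_spread0_free.
move=> x y; rewrite !in_setD spread_last => /andP[_ xi] /andP[_ yi].
by rewrite !inE in xi yi; apply: edge_inj.
Qed.

(** * Separators and the upper bounds *)

Lemma max_trunc_log2_add a b : 0 < a -> 0 < b ->
  let m := maxn (trunc_log 2 a) (trunc_log 2 b) in
  m <= trunc_log 2 (a + b) <= m.+1.
Proof.
move=> a0 b0 /=; set m := maxn _ _; apply/andP; split.
  by rewrite geq_max !leq_trunc_log ?leq_addr ?leq_addl.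
have [am bm] : a < 2 ^ m.+1 /\ b < 2 ^ m.+1.
  split.
    apply: leq_trans (trunc_log_ltn a (isT : 1 < 2)) _.
    by rewrite leq_exp2l // ltnS leq_maxl.
  apply: leq_trans (trunc_log_ltn b (isT : 1 < 2)) _.
  by rewrite leq_exp2l // ltnS leq_maxr.
have ab : 0 < a + b by lia.
rewrite -ltnS -(ltn_exp2l _ _ (isT : 1 < 2)).
apply: leq_ltn_trans (trunc_logP (isT : 1 < 2) ab) _; by rewrite (expnS _ m.+1); lia.
Qed.

Lemma max_trunc_log2_parity a b a' b' : 0 < a -> 0 < b -> 0 < a' -> 0 < b' ->
  a + b = a' + b' ->
  let m := maxn (trunc_log 2 a) (trunc_log 2 b) in
  let m' := maxn (trunc_log 2 a') (trunc_log 2 b') in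
  odd m = odd m' -> m = m'.
Proof.
move=> a0 b0 a0' b0' E m m' odd_m.
have := max_trunc_log2_add a0 b0; rewrite -/m E.
have := max_trunc_log2_add a0' b0'; rewrite -/m'.
move: (trunc_log 2 (a' + b')) odd_m => l; clear; lia.
Qed.

Section Separators.
Variables r n : nat.
Hypothesis r1 : 1 < r.
Implicit Types (x y : {ffun 'I_r -> 'I_n}) (S : pred nat).

(** The last gap is cyclic, running past n - 1 and 0 to the first coordinate. Thus moving any
    coordinate only transfers length between the two gaps around it. *)
Definition gap x c :=
  if c.+1 < r then co x c.+1 - co x c else co x 0 + n - co x c.

Definition gap_log x c := trunc_log 2 (gap x c).

Definition cpred c := if c is c'.+1 then c' else r.-1.

Definition separator x c := (co x c.+1) %/ 2 ^ gap_log x c * 2 ^ gap_log x c.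

Lemma gap_gt0 x c : incr x -> c < r -> 0 < gap x c.
Proof.
move=> /incrP xi cr; rewrite /gap; have := xi _ cr; have := co_lt_n x cr.
case: ifP; lia.
Qed.

Lemma gap_leq x c : incr x -> c < r -> gap x c <= n.
Proof.
move=> xi cr; have := incr_le xi (leq0n c) (ltnW cr).
rewrite /gap; case: ifP => [c1|_]; last lia.
have := co_lt_n x c1; lia.
Qed.

Lemma gap_add_cpred x y c : incr x -> incr y -> c < r -> agree_off c x y ->
  gap x c + gap x (cpred c) = gap y c + gap y (cpred c).
Proof.
move=> xi yi cr xy.
have off := agree_off_co xy.
case: c => [|c] in cr xy off *.
  rewrite /gap /cpred r1 prednK ?ltnn; last by lia.
  rewrite !(off 1) // !(off r.-1); last by lia.
  have r0 : 0 < r by lia.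
  have rr : r.-1 < r by lia.
  have := incr_lt xi (isT : 0 < 1) r0; have := incr_lt yi (isT : 0 < 1) r0.
  rewrite (off 1) //.
  have := co_lt_n y rr; lia.
rewrite /gap /cpred cr; rewrite (off c); last by lia.
have := incr_lt xi (ltnSn c) (ltnW cr); have := incr_lt yi (ltnSn c) (ltnW cr).
rewrite (off c); last by lia.
case: ifP => [c2|c2].
  have := incr_lt xi (ltnSn c.+1) (ltnW c2); have := incr_lt yi (ltnSn c.+1) (ltnW c2).
  by rewrite (off c.+2); lia.
by rewrite (off 0) //; have := co_lt_n x cr; have := co_lt_n y cr; lia.
Qed.

(** A gap of length at least 2^l has the last multiple of 2^l up to its right end beyond its left
    end. *)
Lemma separator_bounds x c : incr x -> c.+1 < r ->
  co x c < separator x c <= co x c.+1.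
Proof.
move=> xi cr; rewrite leq_divM andbT /separator.
have gE : gap x c = co x c.+1 - co x c by rewrite /gap cr.
have := trunc_logP (isT : 1 < 2) (gap_gt0 xi (ltnW cr)).
rewrite -/(gap_log x c) gE.
have P0 : 0 < 2 ^ gap_log x c by rewrite expn_gt0.
move: (2 ^ gap_log x c) P0 => P P0 Pg.
have := divn_eq (co x c.+1) P; have := ltn_pmod (co x c.+1) P0.
have := incr_lt xi (ltnSn c) (ltnW cr); lia.
Qed.

(* As 2^l <= gap < 2^(l+1), the quotient by 2^l grows by one or two across the
   gap; this tells which. *)
Definition low_quotient x c :=
  (co x c.+1) %/ 2 ^ gap_log x c == (co x c %/ 2 ^ gap_log x c).+1.

(** [S] selects the gaps to be guarded. The cyclic last gap is left out, since no coordinate follows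
    it in the linear order. *)
Definition same_separators S x y :=
  [forall c : 'I_r, S c && (c.+1 < r) ==> (separator x c == separator y c)].

Lemma same_separatorsP S x y :
  reflect (forall c, S c -> c.+1 < r -> separator x c = separator y c)
          (same_separators S x y).
Proof.
apply: (iffP forallP) => [h c Sc cr | h c].
  by have /implyP := h (Ordinal (ltnW cr)); rewrite Sc cr => /(_ isT)/eqP.
by apply/implyP => /andP[Sc cr]; rewrite h.
Qed.

Lemma quotient_cases x c : incr x -> c.+1 < r ->
  (co x c.+1) %/ 2 ^ gap_log x c =
  (co x c %/ 2 ^ gap_log x c) + (if low_quotient x c then 1 else 2).
Proof.
move=> xi cr; rewrite /low_quotient; case: eqP => [->|ne]; first by rewrite addn1.
have gE : gap x c = co x c.+1 - co x c by rewrite /gap cr.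
have := trunc_logP (isT : 1 < 2) (gap_gt0 xi (ltnW cr)).
have := trunc_log_ltn (gap x c) (isT : 1 < 2).
rewrite -/(gap_log x c) gE expnS in ne *.
have P0 : 0 < 2 ^ gap_log x c by rewrite expn_gt0.
move: (2 ^ gap_log x c) P0 ne => P P0 ne h1 h2.
have := divn_eq (co x c.+1) P; have := ltn_pmod (co x c.+1) P0.
have := divn_eq (co x c) P; have := ltn_pmod (co x c) P0.
move: (_ %/ P) (_ %% P) (_ %/ P) (_ %% P) ne => q r' q' r'' ne.
move=> m1 e1 m2 e2.
nia.
Qed.

(** Only the two gaps around c change. The separator of gap c is fixed by its scale, its right end
    being constant. In the gap before c the right end moves, but its quotient follows from the
    constant left end, the scale and [low_quotient]. *)
Lemma same_separatorsI S c x y : incr x -> incr y -> c < r -> agree_off c x y ->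
  (S c -> gap_log x c = gap_log y c) ->
  (S (cpred c) -> gap_log x (cpred c) = gap_log y (cpred c)) ->
  low_quotient x (cpred c) = low_quotient y (cpred c) ->
  same_separators S x y.
Proof.
move=> xi yi cr xy lc lp lq; apply/same_separatorsP => d Sd dr.
have off := agree_off_co xy.
case: (eqVneq d c) => [E|dc].
  rewrite /separator (off d.+1); last by rewrite E; lia.
  by rewrite E in Sd *; rewrite lc.
case: (eqVneq d.+1 c) => [E|d1c]; last first.
  by rewrite /separator /gap_log /gap dr !(off d) // !(off d.+1).
have Ep : cpred c = d by rewrite -E.
rewrite Ep in lp lq; rewrite /separator !quotient_cases // lq lp //.
by rewrite (off d).
Qed.

(** Two distinct points with one code would lie on a line in direction c with equal separators, so
    one would arise from the other by a forbidden raise. Hence [code] is injective on A. *)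
Lemma leq_card_independent S (c : 'I_r) (C : finType)
    (A : {set {ffun 'I_r -> 'I_n}}) (code : {ffun 'I_r -> 'I_n} -> C) :
  {in A, forall x, incr x} ->
  {in A &, forall x y, ~~ (raises c x y && same_separators S x y)} ->
  {in A &, forall x y, code x = code y ->
     [/\ agree_off c x y, S c -> gap_log x c = gap_log y c,
         S (cpred c) -> gap_log x (cpred c) = gap_log y (cpred c)
       & low_quotient x (cpred c) = low_quotient y (cpred c)]} ->
  #|A| <= #|C|.
Proof.
move=> Ai indep codeP; apply: (leq_card_in code) => x y xA yA Exy.
have absurd z w : z \in A -> w \in A -> code z = code w -> co z c < co w c -> False.
  move=> zA wA Ezw lt_c; have [off lc lp lq] := codeP z w zA wA Ezw.
  move/negP: (indep _ _ zA wA); apply; rewrite /raises lt_c off /=.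
  by apply: same_separatorsI off lc lp lq; rewrite ?ltn_ord //; apply: Ai.
have [off _ _ _] := codeP x y xA yA Exy.
apply: co_inj => d dr; case: (eqVneq d c) => [->|dc]; last exact: agree_off_co off dc.
case: (ltngtP (co x c) (co y c)) => // h.
- by case: (absurd x y).
- by case: (absurd y x).
Qed.

End Separators.

(** The leading binary digit of the sum determines the exponent. *)
Lemma exp2_add_inj k l a b :
  a < 2 ^ k -> b < 2 ^ l -> 2 ^ k + a = 2 ^ l + b -> k = l /\ a = b.
Proof.
move=> ak bl E; suff kl : k = l by split=> //; move: E; rewrite kl; lia.
rewrite -(@trunc_log_eq 2 k (2 ^ k + a)) //; last by rewrite expnS; lia.
by rewrite E; apply: trunc_log_eq; rewrite // expnS; lia.
Qed.

(** * Counting independent families on lines in one direction *)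

Section Counting.
Variables r n : nat.
Hypothesis r1 : 1 < r.
Implicit Types (x y : {ffun 'I_r -> 'I_n}) (S : pred nat) (c : 'I_r).

Definition max_log x (c : nat) := maxn (gap_log x (cpred r c)) (gap_log x c).
Definition min_log x (c : nat) := minn (gap_log x (cpred r c)) (gap_log x c).
(** Three bits: which of the two scales around c is the larger, the parity of that one, and the
    growth of the quotient across the gap before c. They account for the factor 8 in the counts. *)
Definition flags x (c : nat) :=
  (gap_log x (cpred r c) <= gap_log x c, odd (max_log x c), low_quotient x (cpred r c)).

Lemma cpred_lt (c : nat) : c < r -> cpred r c < r.
Proof. by case: c => [|c] /= cr; lia. Qed.

(* The two gaps around coordinate c have a known sum, so the larger of their
   scales takes two consecutive values, which the parity in [flags] separates. *)
Lemma max_log_eq x y c : incr x -> incr y -> agree_off c x y ->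
  flags x c = flags y c -> max_log x c = max_log y c.
Proof.
move=> xi yi xy [_ odd_xy _]; have cr := ltn_ord c; have pr := cpred_lt cr.
apply: max_trunc_log2_parity odd_xy; rewrite ?(gap_gt0 r1) //.
by have := gap_add_cpred r1 xi yi cr xy; lia.
Qed.

Lemma gap_logs_eq x y c : incr x -> incr y -> agree_off c x y ->
  flags x c = flags y c -> min_log x c = min_log y c ->
  gap_log x c = gap_log y c /\ gap_log x (cpred r c) = gap_log y (cpred r c).
Proof.
move=> xi yi xy F; have := max_log_eq xi yi xy F; case: F => [+ _ _].
rewrite /max_log /min_log; move: (gap_log _ _) (gap_log _ _) (gap_log _ _) (gap_log _ _).
by move=> a b a' b'; lia.
Qed.

Lemma agree_off_lift x y c :
  (forall j : 'I_r.-1, co x (lift c j) = co y (lift c j)) -> agree_off c x y.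
Proof.
move=> h; apply/agree_offP => i ir ic.
case: (unliftP c (Ordinal ir)) => [j E|E].
  by have := h j; rewrite -E.
by move: ic; rewrite -E /= eqxx.
Qed.

Definition independent S c (A : {set {ffun 'I_r -> 'I_n}}) :=
  {in A, forall x, incr x} /\
  {in A &, forall x y, ~~ (raises c x y && same_separators S x y)}.

(** The flags give the larger scale around c, so only the smaller one, with its [(trunc_log 2 n).+1]
    values, must be recorded next to the other r - 1 coordinates. *)
Lemma leq_card_independent_log S c A : independent S c A ->
  #|A| <= 8 * (trunc_log 2 n).+1 * n ^ r.-1.
Proof.
move=> [Ai indep].
pose code x : (bool * bool * bool) * 'I_(trunc_log 2 n).+1 * {ffun 'I_r.-1 -> 'I_n} :=
  (flags x c, inord (min_log x c), [ffun j => x (lift c j)]).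
apply: leq_trans (leq_card_independent r1 (code := code) Ai indep _) _.
- move=> x y xA yA [/= F1 F2 F3 M O].
  have xi := Ai _ xA; have yi := Ai _ yA.
  have xy : agree_off c x y.
    by apply: agree_off_lift => j; have /ffunP/(_ j) := O; rewrite !ffunE !coE => ->.
  have F : flags x c = flags y c by rewrite /flags F1 F2 F3.
  have ml z : z \in A -> min_log z c < (trunc_log 2 n).+1.
    move=> /Ai zi; rewrite ltnS geq_min; apply/orP; right.
    by apply: leq_trunc_log; apply: gap_leq.
  have {}M : min_log x c = min_log y c.
    by move: M => /(congr1 val); rewrite /= !inordK ?ml.
  by have [] := gap_logs_eq xi yi xy F M; split.
- by rewrite !card_prod !card_bool card_ffun !card_ord.
Qed.

(** If the unguarded smallest gap g borders c, the only scale needed is the larger one, known from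
    the flags. Otherwise the smaller scale around c is at least that of gap g, so the pair can be
    stored in the place of a single coordinate. *)
Lemma leq_card_independent_min S c A (g : nat) : independent S c A -> g < r ->
  ~~ S g -> {in A, forall x d, d < r -> gap x g <= gap x d} ->
  #|A| <= 8 * (4 * n).+1 ^ r.-1.
Proof.
move=> [Ai indep] gr Sg gmin.
have cr := ltn_ord c; have pr := cpred_lt cr.
case: (boolP ((g == c) || (g == cpred r c))) => [gc|].
  pose code x : (bool * bool * bool) * {ffun 'I_r.-1 -> 'I_n} :=
    (flags x c, [ffun j => x (lift c j)]).
  apply: leq_trans (leq_card_independent r1 (code := code) Ai indep _) _.
  - move=> x y xA yA [/= F1 F2 F3 O].
    have xi := Ai _ xA; have yi := Ai _ yA.
    have xy : agree_off c x y.
      by apply: agree_off_lift => j; have /ffunP/(_ j) := O; rewrite !ffunE !coE => ->.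
    have F : flags x c = flags y c by rewrite /flags F1 F2 F3.
    have := max_log_eq xi yi xy F; rewrite /max_log.
    have lg z d : z \in A -> d < r -> gap_log z g <= gap_log z d.
      by move=> zA dr; apply: leq_trunc_log; apply: gmin.
    have := lg _ _ xA pr; have := lg _ _ yA pr.
    have := lg _ _ xA cr; have := lg _ _ yA cr.
    case/orP: gc => /eqP E; rewrite E in Sg *; rewrite (negPf Sg) => ? ? ? ? ?;
      split=> // _; lia.
  - rewrite !card_prod !card_bool card_ffun !card_ord leq_mul2l /=.
    by rewrite leq_exp2r; lia.
rewrite negb_or => /andP[gc gp].
pose h := if g.+1 < r then g.+1 else 0.
have hr : h < r by rewrite /h; case: ifP => //; lia.
have hc : h != c.
  move: gp; rewrite /h /cpred; case: ifP; case: (nat_of_ord c) (ltn_ord c) => /=; lia.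
have hg : h != g by rewrite /h; case: ifP; lia.
(* As gap g < 2^(min_log + 1), one number below 4n + 1 encodes both the scale and
   gap g; it takes the slot of coordinate h, which gap g determines. *)
pose N x := 2 ^ (min_log x c).+1 + gap x g.
have gap_lt z : z \in A -> gap z g < 2 ^ (min_log z c).+1.
  move=> zA; rewrite /min_log /minn; case: ifP => _.
    by apply: leq_ltn_trans (gmin _ zA _ pr) (trunc_log_ltn _ _).
  by apply: leq_ltn_trans (gmin _ zA _ cr) (trunc_log_ltn _ _).
have N_lt z : z \in A -> N z < (4 * n).+1.
  move=> zA; have zi := Ai _ zA; rewrite /N expnS.
  have P : 2 ^ min_log z c <= gap z c.
    apply: leq_trans (trunc_logP (isT : 1 < 2) (gap_gt0 r1 zi cr)).
    by rewrite leq_exp2l // geq_minr.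
  by have := gap_leq r1 zi cr; have := gap_leq r1 zi gr; lia.
pose code x : (bool * bool * bool) * {ffun 'I_r.-1 -> 'I_(4 * n).+1} :=
  (flags x c, [ffun j => inord (if lift c j == h :> nat then N x else co x (lift c j))]).
apply: leq_trans (leq_card_independent r1 (code := code) Ai indep _) _; last first.
  by rewrite !card_prod !card_bool card_ffun !card_ord.
move=> x y xA yA E; have F : flags x c = flags y c := congr1 fst E.
have {E} O := congr1 snd E : (code x).2 = (code y).2.
have xi := Ai _ xA; have yi := Ai _ yA.
have O_off j : lift c j != h :> nat -> co x (lift c j) = co y (lift c j).
  move=> jh; have /ffunP/(_ j) := O; rewrite !ffunE (negPf jh) => /(congr1 val).
  have lt (z : {ffun 'I_r -> 'I_n}) : co z (lift c j) < (4 * n).+1.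
    by have := co_lt_n z (ltn_ord (lift c j)); lia.
  by rewrite /= !inordK.
have [NE GE] : (min_log x c).+1 = (min_log y c).+1 /\ gap x g = gap y g.
  apply: exp2_add_inj; rewrite ?gap_lt //.
  case: (unliftP c (Ordinal hr)) => [j E|E]; last by move: hc; rewrite -E /= eqxx.
  have /ffunP/(_ j) := O; rewrite !ffunE -E /= eqxx => /(congr1 val).
  by rewrite /= !inordK ?N_lt.
have O_g : co x g = co y g.
  case: (unliftP c (Ordinal gr)) => [j E|E]; last by move: gc; rewrite -E /= eqxx.
  by have := O_off j; rewrite -E /= eq_sym => ->.
have xy : agree_off c x y.
  apply: agree_off_lift => j; case: (eqVneq (lift c j : nat) h) => [->|].
    2: exact: O_off.
  move: GE; rewrite /gap /h; case: ifP => g1.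
    have := incr_lt xi (ltnSn g) gr; have := incr_lt yi (ltnSn g) gr; lia.
  have := co_lt_n x gr; have := co_lt_n y gr; lia.
have [lc lp] := gap_logs_eq xi yi xy F (succn_inj NE).
by case: F => _ _; split.
Qed.

End Counting.

Section UpperBounds.
Variables r n : nat.
Hypothesis r1 : 1 < r.
Implicit Types (x y : {ffun 'I_r -> 'I_n}) (S : pred nat).

(** The separator of gap c is constant along the chain; at all times coordinate c is below it and
    the later coordinates are not. *)
Lemma chain_separated S (X : nat -> {ffun 'I_r -> 'I_n}) m :
  (forall t, t <= m -> incr (X t)) ->
  (forall t, t < m -> same_separators S (X t) (X t.+1)) ->
  forall c c' t t', S c -> c < c' -> c' < r -> t <= m -> t' <= m ->
    co (X t) c < co (X t') c'.
Proof.
move=> Xi XS c c' t t' Sc cc' c'r tm t'm.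
have c1r : c.+1 < r by lia.
have sep0 u : u <= m -> separator (X u) c = separator (X 0) c.
  elim: u => // u IH um; rewrite -IH ?(ltnW um) //.
  by apply/esym; apply: (same_separatorsP _ _ _ (XS u um)).
have /andP[h _] := separator_bounds r1 (Xi t tm) c1r.
have /andP[_ h'] := separator_bounds r1 (Xi t' t'm) c1r.
have := incr_le (Xi t' t'm) cc' (ltnW c'r).
by move: h h'; rewrite !sep0 //; lia.
Qed.

Lemma leq_card_no_chain S (D : {set {ffun 'I_r -> 'I_n}}) m s L :
  {in D, forall x, incr x} ->
  (forall (c : 'I_r) (A : {set {ffun 'I_r -> 'I_n}}), A \subset D ->
     independent S c A -> #|A| <= L) ->
  (forall X : nat -> {ffun 'I_r -> 'I_n}, (forall t, t <= m -> X t \in D) ->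
     (forall t, t < m -> raises ((s + t) %% r) (X t) (X t.+1)) ->
     (forall t, t < m -> same_separators S (X t) (X t.+1)) -> False) ->
  #|D| <= m * L.
Proof.
move=> Di indepL no_chain; have r0 : 0 < r by lia.
pose M t : rel {ffun 'I_r -> 'I_n} :=
  fun x y => raises ((s + t) %% r) x y && same_separators S x y.
suff reach0 : reach D m M = set0.
  apply: leq_trans (card_reach (m := m) (M := M) (L := fun=> L) _) _.
    move=> j A _ AD indep; have sr : (s + j) %% r < r by rewrite ltn_pmod.
    by apply: (indepL (Ordinal sr)) => //; split=> // x /(subsetP AD)/Di.
  by rewrite reach0 cards0 add0n sum_nat_const card_ord.
apply/eqP; apply: contraT => /set0Pn[x /reach_chain[X [_ XD XM]]].
by case: (no_chain X XD) => t /XM /andP[].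
Qed.

Lemma leq_card_crossing_free_log k (E : uniform_sets r n) : 0 < k ->
  ~~ contains (clockwise_cgh E) (crossing_path r k) ->
  #|paths_of r (val E)| <= k.-1 * (8 * (trunc_log 2 n).+1 * n ^ r.-1).
Proof.
move=> k0 NE; apply: (@leq_card_no_chain predT _ k.-1 0).
- by move=> x; rewrite inE => /andP[].
- by move=> c A _; apply: leq_card_independent_log.
move=> X XE Xr XS; move/negP: NE; apply.
apply: (chain_contains (s := 0) (X := X)) => //; first by lia.
- by move=> t tk; apply: XE; lia.
- by move=> t tk; apply: Xr; lia.
move=> c c' t t' cc' c'r tk t'k.
apply: (chain_separated (m := k.-1)) XS _ _ _ _ _ _ _ _ _ => //; try lia.
by move=> u /XE; rewrite inE => /andP[].
Qed.

Lemma leq_card_crossing_free_gap k g (E : uniform_sets r n) : 0 < k ->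
  k <= 2 * r - 1 -> g < r ->
  ~~ contains (clockwise_cgh E) (crossing_path r k) ->
  #|[set x in paths_of r (val E) | [forall d : 'I_r, gap x g <= gap x d]]| <=
    k.-1 * (8 * (4 * n).+1 ^ r.-1).
Proof.
move=> k0 kr gr NE; set D := [set x in _ | _].
have DE x : x \in D -> x \in paths_of r (val E) by rewrite inE => /andP[].
have Di x : x \in D -> incr x by move/DE; rewrite inE => /andP[].
have Dmin x : x \in D -> forall d, d < r -> gap x g <= gap x d.
  rewrite inE => /andP[_ /forallP h] d dr; exact: h (Ordinal dr).
have r0 : 0 < r by lia.
(* Starting at g + 2 modulo r, coordinates g and g + 1 are raised by moves r - 2 and r - 1, last in
   the first round, and neither recurs among the k - 1 <= 2r - 2 moves. *)
apply: (@leq_card_no_chain (predC1 g) _ k.-1 (g + 2)) => //.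
- move=> c A AD indep; apply: (leq_card_independent_min r1 indep gr).
    by rewrite /= eqxx.
  by move=> x /(subsetP AD)/Dmin.
move=> X XD Xr XS; move/negP: NE; apply.
have Xi u : u <= k.-1 -> incr (X u) by move=> /XD/Di.
have sep := chain_separated Xi XS.
have mono := raises_chain_leq Xr; have const := raises_chain_const Xr.
apply: (chain_contains (s := (g + 2) %% r) (X := X)); rewrite ?ltn_pmod //.
- by move=> t tk; apply/DE/XD; lia.
- by move=> t tk; rewrite modnDml; apply: Xr; lia.
move=> c c' t t' cc' c'r tk t'k.
case: (eqVneq c g) => [E1|cg]; last by apply: sep => //; lia.
rewrite {}E1 in cc' *; case: (ltngtP c' g.+1) => [||Ec']; first by lia.
  (* Beyond g + 1, the guarded gap g + 1 does the separating. *)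
  move=> gc'; apply: ltn_trans (incr_lt (Xi t _) (ltnSn g) _) _; try lia.
  by apply: sep => //=; lia.
(* Coordinates g and g + 1 move once each, g first: at time r - 1 the former is
   final and the latter initial. *)
rewrite Ec'; pose T := minn r.-1 k.-1.
have le_g : co (X t) g <= co (X T) g.
  case: (leqP t T) => tT; first by apply: mono; lia.
  rewrite (const g T t) //; try lia.
  move=> u uT; rewrite -[X in _ != X](modn_small gr) -(modnDr g r) eq_sym.
  by apply: modn_window; lia.
have ge_g : co (X T) g.+1 <= co (X t') g.+1.
  case: (leqP T t') => tT; first by apply: mono; lia.
  rewrite -(const g.+1 t' T) //; try lia.
  have g1r : g.+1 < r by lia.
  move=> u uT; rewrite -[X in _ != X](modn_small g1r) eq_sym.
  by apply: modn_window; lia.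
have := incr_lt (Xi T _) (ltnSn g); lia.
Qed.

(** The family is covered by r subfamilies according to the place g of a smallest gap. *)
Lemma leq_card_crossing_free k (E : uniform_sets r n) : 0 < k ->
  k <= 2 * r - 1 -> ~~ contains (clockwise_cgh E) (crossing_path r k) ->
  #|paths_of r (val E)| <= r * (k.-1 * (8 * (4 * n).+1 ^ r.-1)).
Proof.
move=> k0 kr NE.
pose D g := [set x in paths_of r (val E) | [forall d : 'I_r, gap x g <= gap x d]].
have r0 : 0 < r by lia.
apply: leq_trans (_ : #|\bigcup_(g < r) D g| <= _).
  apply/subset_leq_card/subsetP => x xE; apply/bigcupP.
  have [g _ gmin] := arg_minnP (fun d : 'I_r => gap x d) (isT : predT (Ordinal r0)).
  by exists g => //; rewrite inE xE; apply/forallP => d; apply: gmin.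
apply: leq_trans (_ : \sum_(g < r) #|D g| <= _).
  elim/big_rec2: _ => [|i A m _ IH]; first by rewrite cards0.
  by apply: leq_trans (leq_card_setU _ _) _; rewrite leq_add2l.
have -> B : r * B = \sum_(g < r) B by rewrite sum_nat_const card_ord.
by apply: leq_sum => g _; apply: leq_card_crossing_free_gap.
Qed.

End UpperBounds.

(** * Lower bounds *)

(** The n classes of r-sets by vertex sum modulo n partition all r-sets. Each class is free of the
    path: its two edges share r - 1 vertices, so equal sums would identify the two remaining
    ones. *)
Lemma crossing_path2_lower r n : 0 < r -> 0 < n ->
  'C(n, r) <= n * ex_cyc n (crossing_path r 2).
Proof.
move=> r0 n0.
pose Es (t : 'I_n) := [set e : {set 'I_n} | (#|e| == r) && ((\sum_(v in e) v) %% n == t)].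
have -> : 'C(n, r) = \sum_(t < n) #|Es t|.
  rewrite -[X in 'C(X, r)]card_ord -card_draws -sum1_card.
  pose res (e : {set 'I_n}) := Ordinal (ltn_pmod (\sum_(v in e) v) n0).
  rewrite (partition_big res predT) //=.
  apply: eq_bigr => t _; rewrite -sum1_card; apply: eq_bigl => e.
  by rewrite !inE -val_eqE.
have -> B : n * B = \sum_(t < n) B by rewrite sum_nat_const card_ord.
apply: leq_sum => t _; apply: uniform_sets_leq_ex_cyc.
  by move=> e; rewrite inE => /andP[/eqP].
move=> E EE; apply/existsP => -[f /and3P[/injectiveP f_inj _ /forall_inP fE]].
pose M := [set j : 'I_(2 + r - 1) | 1 <= j < r].
have v0P : 0 < 2 + r - 1 by lia.
have vrP : r < 2 + r - 1 by lia.
have sum_f (e : {set 'I_(2 + r - 1)}) : e \in tight_path_edges r 2 ->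
    (\sum_(j in e) f j) %% n = t.
  move/fE; rewrite [edges _]EE inE => /andP[_ /eqP <-].
  by rewrite big_imset //= => x y _ _; apply: f_inj.
have e0 : \sum_(j in [set j : 'I_(2 + r - 1) | 0 <= j < 0 + r]) f j =
    f (Ordinal v0P) + \sum_(j in M) f j :> nat.
  rewrite (bigD1 (Ordinal v0P)) ?inE //=; congr addn; apply: eq_bigl => j.
  by rewrite !inE -val_eqE /=; lia.
have e1 : \sum_(j in [set j : 'I_(2 + r - 1) | 1 <= j < 1 + r]) f j =
    f (Ordinal vrP) + \sum_(j in M) f j :> nat.
  rewrite (bigD1 (Ordinal vrP)) ?inE /=; last by lia.
  congr addn; apply: eq_bigl => j.
  by rewrite !inE -val_eqE /=; lia.
have s0 := sum_f _ (imset_f (fun i : 'I_2 => [set j : 'I_(2 + r - 1) | i <= j < i + r])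
   (isT : Ordinal (isT : 0 < 2) \in predT)).
have s1 := sum_f _ (imset_f (fun i : 'I_2 => [set j : 'I_(2 + r - 1) | i <= j < i + r])
   (isT : Ordinal (isT : 1 < 2) \in predT)).
rewrite e0 in s0; rewrite e1 -s0 in s1.
move/eqP: s1; rewrite eqn_modDr !modn_small // => /eqP/val_inj/f_inj/(congr1 val) /=.
lia.
Qed.

(** * Families whose lowest gap is a power of two *)

Definition is_pow2 d := 2 ^ trunc_log 2 d == d.

Lemma is_pow2_exp a : is_pow2 (2 ^ a).
Proof. by rewrite /is_pow2 trunc_expnK. Qed.

Lemma is_pow2_ltn a b : is_pow2 a -> is_pow2 b -> a < b -> 2 * a <= b.
Proof.
move=> /eqP <- /eqP <-; rewrite ltn_exp2l // -expnS => ab.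
by rewrite leq_exp2l.
Qed.

(** The differences u - w and u' - w' are each at most half of u' - w, yet their intervals overlap
    and cover it, so they sum to more. *)
Lemma is_pow2_crossing w w' u u' : w < w' -> w' < u -> u < u' ->
  is_pow2 (u - w) -> is_pow2 (u' - w) -> is_pow2 (u' - w') -> False.
Proof.
move=> ww' w'u uu' h1 h2 h3.
have := is_pow2_ltn h1 h2; have := is_pow2_ltn h3 h2; lia.
Qed.

(** Doubling gives u - w1 <= w1 - w0 and w1 - y <= w2 - w1, so w1 - w0 < w1 - y <= w2 - w1 < u - w1
    <= w1 - w0. *)
Lemma is_pow2_nested y w0 w1 w2 u : y < w0 -> w0 < w1 -> w1 < w2 -> w2 < u ->
  is_pow2 (u - w0) -> is_pow2 (u - w1) -> is_pow2 (w1 - y) -> is_pow2 (w2 - y) ->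
  False.
Proof.
move=> yw0 w01 w12 w2u h1 h2 h3 h4.
have := is_pow2_ltn h2 h1; have := is_pow2_ltn h3 h4; lia.
Qed.

Lemma modnS_cases r i : 1 < r ->
  (i.+1 %% r = (i %% r).+1 /\ (i %% r).+1 < r) \/ (i.+1 %% r = 0 /\ (i %% r).+1 = r).
Proof.
move=> r1; rewrite -add1n modnD_small //.
by have := ltn_pmod i (ltnW r1); case: (ltnP (i %% r + 1) r); lia.
Qed.

Lemma window_neq r i a b :
  i <= a < i + r -> i <= b < i + r -> a != b -> a %% r != b %% r.
Proof.
move=> ai bi; rewrite neq_ltn => /orP[ab|ba]; first by apply: modn_window; lia.
by rewrite eq_sym; apply: modn_window; lia.
Qed.

(* F i is the position of v_i and v_m the path vertex of least position, so that
   the clockwise order from v_m becomes the order of positions.  [F_low] is the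
   power-of-two property of the edge {v_i, ..., v_(i+r-1)}. *)
Section NoLongCrossingPath.
Variables (r N m : nat) (F : nat -> nat).
Hypothesis r1 : 1 < r.
Hypothesis NE : N = 3 * r - 1.
Hypothesis mN : m < N.
Let lt i j := (i %% r < j %% r) || (i %% r == j %% r) && (i < j).
Hypothesis F_min : forall i, i < N -> i != m -> F m < F i.
Hypothesis F_cyc : forall i j, i < N -> j < N -> i != m -> j != m ->
  cyclic_of lt m i j -> F i < F j.
Hypothesis F_low : forall i w u, i < 2 * r -> i <= w < i + r -> i <= u < i + r ->
  F w < F u -> (forall z, i <= z < i + r -> z != w -> z != u -> F u < F z) ->
  is_pow2 (F u - F w).

Let modr i : i %% r < r.
Proof. by apply: ltn_pmod; lia. Qed.

Let modDr i : (i + r) %% r = i %% r.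
Proof. exact: modnDr. Qed.

(** Clockwise from v_m come the vertices of the class of m with index at least m, then the classes
    of m + 1, m + 2, ..., and finally the rest of the class of m. Only that class is split. *)
Lemma F_same_residue i j : i < j -> j < N -> i %% r = j %% r ->
  (i %% r = m %% r -> j < m \/ m <= i) -> F i < F j.
Proof.
move=> ij jN Eij h; case: (eqVneq i m) => [im|im]; first by rewrite im; apply: F_min; lia.
apply: F_cyc; [lia | lia | by [] | | ].
  apply/eqP => jm; have /h : i %% r = m %% r by rewrite Eij jm.
  lia.
rewrite /cyclic_of /lt -Eij; move: (i %% r) (m %% r) h => a b; lia.
Qed.

Lemma F_next_residue w u : m <= w -> w < N -> u < N -> w %% r = m %% r ->
  u %% r = m.+1 %% r -> F w < F u.
Proof.
move=> mw wN uN wm um; have um' : u != m.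
  by apply/eqP => E; move: um; rewrite E; have := modnS_cases m r1; lia.
case: (eqVneq w m) => [->|wm']; first exact: F_min.
apply: F_cyc => //; rewrite /cyclic_of /lt wm um.
have mw' : m < w by rewrite ltn_neqAle eq_sym wm'.
rewrite mw'; case: (modnS_cases m r1) => -[-> h];
  move: (m %% r) (w < u) (u < m) h (r1); clear=> a [] [] h h1; lia.
Qed.

(** As w is in the leading part of the class of m and u in the next class, they are the two lowest
    vertices of their edge. *)
Lemma low_pair w u i : i < 2 * r -> i <= w < i + r -> i <= u < i + r ->
  m <= w -> w %% r = m %% r -> u %% r = m.+1 %% r -> is_pow2 (F u - F w).
Proof.
move=> i2r wi ui mw wm um; have [wN uN] : w < N /\ u < N by lia.
apply: (F_low i2r wi ui); first exact: F_next_residue.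
move=> z zi zw zu.
have zw' := window_neq zi wi zw; have zu' := window_neq zi ui zu.
rewrite wm in zw'; rewrite um in zu'.
apply: F_cyc; [lia | lia | | | ].
- by apply/eqP => E; move: um; rewrite E; have := modnS_cases m r1; lia.
- by apply: contraNneq zw' => ->.
rewrite /cyclic_of /lt um.
move: zw' zu' (modr z); case: (modnS_cases m r1) => -[-> h];
  move: (m %% r) (z %% r) (m < u) (u < z) (z < m) (m < z) h (r1); clear;
  by move=> a b [] [] [] []; lia.
Qed.

Lemma F_next2_residue w u : w < N -> u < m -> w %% r = m.+1 %% r ->
  u %% r = m.+2 %% r -> F w < F u.
Proof.
move=> wN um wm um2.
apply: F_cyc; [lia | lia | | lia | ].
  by apply/eqP => E; move: wm; rewrite E; have := modnS_cases m r1; lia.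
rewrite /cyclic_of /lt wm um2.
rewrite um; have := modnS_cases m.+1 r1.
case: (modnS_cases m r1) => -[-> h]; case=> -[-> h'];
  move: (m %% r) (m < w) (w < u) (w < m) h h' (r1); clear=> a [] [] [] h h' h1; lia.
Qed.

(** All indices of the edge are below m, so its vertex in the class of m comes last and the classes
    of m + 1 and m + 2 supply the two lowest. *)
Lemma low_pair2 w u i : i + r <= m -> i <= w < i + r -> i <= u < i + r ->
  w %% r = m.+1 %% r -> u %% r = m.+2 %% r -> is_pow2 (F u - F w).
Proof.
move=> im wi ui wm um; have [wN uN] : w < N /\ u < N by lia.
apply: (@F_low i) => //; [lia | by apply: F_next2_residue => //; lia | ].
move=> z zi zw zu.
have zw' := window_neq zi wi zw; have zu' := window_neq zi ui zu.
rewrite wm in zw'; rewrite um in zu'.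
have [um' zm] : u < m /\ z < m by move: im ui zi; clear; lia.
have [u_m z_m] : u != m /\ z != m by move: um' zm; clear; lia.
have zN := ltn_trans zm mN.
apply: F_cyc => //.
rewrite /cyclic_of /lt um zm.
rewrite (leq_gtF (ltnW um')); move: zw' zu' (modr z); have := modnS_cases m.+1 r1.
case: (modnS_cases m r1) => -[-> h]; case=> -[-> h'];
  move: (m %% r) (z %% r) (m < u) (u < z) (m < z) h h' (r1);
  clear=> a b [] [] [] h h' h1; lia.
Qed.

Ltac lia_no_mod :=
  repeat match goal with H : context [modn] |- _ => clear H end; lia.

Lemma no_long_crossing_path : False.
Proof.
case: (leqP m (2 * r - 2)) => m2r.
  (* With v = w - (r - 1), in the class of m + 1, the positions of w, w + r, v, v + r increase. The
     edges starting at v, v + 1 and v + r have lowest pairs (w, v), (w, v + r) and (w + r, v + r),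
     which is the crossing pattern. *)
  have [w [wr mw wm]] : exists w, [/\ r.-1 <= w <= 2 * r - 2, m <= w & w %% r = m %% r].
    case: (leqP r.-1 m) => mr; first by exists m; split=> //; lia_no_mod.
    by exists (m + r); rewrite modDr; split=> //; lia_no_mod.
  have [v vE] : exists v, w = v + r.-1 by exists (w - r.-1); lia_no_mod.
  have vm : v %% r = m.+1 %% r.
    rewrite -(modDr v) (_ : v + r = w.+1); last by lia_no_mod.
    by rewrite -addn1 -[m.+1]addn1 -modnDml wm modnDml.
  apply: (@is_pow2_crossing (F w) (F (w + r)) (F v) (F (v + r))).
  - by apply: F_same_residue; rewrite ?modDr //; lia_no_mod.
  - by apply: F_next_residue; rewrite ?modDr //; lia_no_mod.
  - apply: F_same_residue; rewrite ?modDr //; [lia_no_mod | lia_no_mod |].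
    by rewrite vm; case: (modnS_cases m r1) => -[-> ?] ?; exfalso; lia.
  - by apply: (low_pair (i := v)) => //; lia_no_mod.
  - by apply: (low_pair (i := v.+1)); rewrite ?modDr //; lia_no_mod.
  - by apply: (low_pair (i := v + r)); rewrite ?modDr //; lia_no_mod.
have [v vE] : exists v, m.+1 = v + 2 * r by exists (m.+1 - 2 * r); lia_no_mod.
have vm : v %% r = m.+1 %% r by rewrite vE mul2n -addnn addnA !modDr.
have v1m : v.+1 %% r = m.+2 %% r by rewrite -addn1 -[m.+2]addn1 -modnDml vm modnDml.
have not_m : v %% r != m %% r.
  by rewrite vm; case: (modnS_cases m r1) => -[-> ?]; lia.
case: (ltnP m (3 * r - 2)) => m3r.
  (* Here v + 2r = m + 1 is still on the path. The edges starting at 0 and v + 1 pair v + 1 with v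
     and v + r; those starting at v + r and v + r + 1 pair m with v + r and v + 2r. *)
  apply: (@is_pow2_nested (F m) (F v) (F (v + r)) (F (v + r + r)) (F v.+1)).
  - by apply: F_min; lia_no_mod.
  - apply: F_same_residue; rewrite ?modDr //; [lia_no_mod | lia_no_mod |].
    by move/eqP; rewrite (negPf not_m).
  - apply: F_same_residue; rewrite ?modDr //; [lia_no_mod | lia_no_mod |].
    by move/eqP; rewrite (negPf not_m).
  - by apply: F_next2_residue; rewrite ?modDr //; lia_no_mod.
  - by apply: (low_pair2 (i := 0)) => //; lia_no_mod.
  - by apply: (low_pair2 (i := v.+1)); rewrite ?modDr //; lia_no_mod.
  - by apply: (low_pair (i := v + r)); rewrite ?modDr //; lia_no_mod.
  - by apply: (low_pair (i := v.+1 + r)); rewrite ?modDr //; lia_no_mod.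
(* Now m is the last index 3r - 2, and the edges starting at 0, 1 and r give the crossing pattern on
   r - 1, 2r - 1, 0, r. *)
have Ev : v = r.-1 by lia_no_mod.
have v0 : 0 %% r = m.+2 %% r by rewrite -v1m Ev prednK ?modnn ?mod0n //; lia_no_mod.
apply: (@is_pow2_crossing (F v) (F (v + r)) (F 0) (F r)).
- apply: F_same_residue; rewrite ?modDr //; [lia_no_mod | lia_no_mod |].
    by move/eqP; rewrite (negPf not_m).
- by apply: F_next2_residue; rewrite ?modDr //; lia_no_mod.
- apply: F_same_residue; rewrite ?modnn ?mod0n //; [lia_no_mod | lia_no_mod |].
  by left; lia_no_mod.
- by apply: (low_pair2 (i := 0)) => //; lia_no_mod.
- by apply: (low_pair2 (i := 1)); rewrite ?modnn -?v0 ?mod0n //; lia_no_mod.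
- by apply: (low_pair2 (i := r)); rewrite ?modDr ?modnn -?v0 ?mod0n //; lia_no_mod.
Qed.

End NoLongCrossingPath.

Definition low_gap_pow2 n (e : {set 'I_n}) :=
  [forall w : 'I_n, forall u : 'I_n,
    [&& w \in e, u \in e, w < u &
      [forall z in e, [|| z == w, z == u | (u < z)]]] ==> is_pow2 (u - w)].

Definition pow2_sets r n := [set e : {set 'I_n} | (#|e| == r) && low_gap_pow2 e].

Lemma pow2_sets_free r n (E : uniform_sets r n) : 1 < r ->
  val E = pow2_sets r n ->
  ~~ contains (clockwise_cgh E) (crossing_path r (2 * r)).
Proof.
move=> r1 EE; apply/existsP => -[f /and3P[/injectiveP f_inj
  /'forall_'forall_forallP fc /forall_inP fE]].
set N := 2 * r + r - 1 in f f_inj fc fE.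
have NE : N = 3 * r - 1 by rewrite /N; lia.
have N0 : 0 < N by lia.
have [m _ m_min] := arg_minnP (fun i : 'I_N => f i : nat) (isT : predT (Ordinal N0)).
pose F (i : nat) := co (f : {ffun 'I_N -> 'I_n}) i.
have FE (i : 'I_N) : F i = f i by rewrite /F coE.
have F_min i : i < N -> i != m -> F m < F i.
  move=> iN im; rewrite -[i]/(val (Ordinal iN)) !FE ltn_neqAle m_min // andbT.
  apply: contraNneq im => /val_inj/f_inj Em; by rewrite Em.
apply: (no_long_crossing_path r1 NE (ltn_ord m) F_min) => [i j iN jN im jm cyc_ij|].
  have := implyP (fc m (Ordinal iN) (Ordinal jN)) cyc_ij.
  have := F_min i iN im; have := F_min j jN jm.
  rewrite /= /cyclic_of /ltord -!FE /=.
  by move: (F i) (F j) (F m); clear=> a b c; lia.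
move=> i w u i2r wi ui wu low.
have [wN uN] : w < N /\ u < N by rewrite /N; move: wi ui i2r; clear; lia.
have := fE _ (imset_f (fun i : 'I_(2 * r) => [set j : 'I_N | i <= j < i + r])
  (isT : Ordinal i2r \in predT)).
rewrite [edges _]EE inE => /andP[_].
move=> /forallP/(_ (f (Ordinal wN)))/forallP/(_ (f (Ordinal uN))).
rewrite -!FE /= => /implyP; apply; apply/and4P; split=> //.
- by rewrite imset_f // inE.
- by rewrite imset_f // inE.
apply/forall_inP => _ /imsetP[z + ->]; rewrite inE /= => zi.
case: (eqVneq z (Ordinal wN)) => [->|zw]; first by rewrite eqxx.
case: (eqVneq z (Ordinal uN)) => [->|zu]; first by rewrite eqxx orbT.
by rewrite -FE low ?orbT.
Qed.

(** Cut off r blocks of length q. Coordinate 0 is free in the first block, coordinate 1 exceeds it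
    by 2^a <= q and so stays below 2q, and each later coordinate is free in its own block. *)
Lemma leq_card_pow2_sets r n : 1 < r -> 0 < n %/ r ->
  (n %/ r) ^ r.-1 * (trunc_log 2 (n %/ r)).+1 <= #|pow2_sets r n|.
Proof.
move=> r1; set q := n %/ r => q0.
have qn : r * q <= n by rewrite mulnC leq_divM.
pose P : finType := ({ffun 'I_r.-1 -> 'I_q} * 'I_(trunc_log 2 q).+1)%type.
have cardP : #|P| = q ^ r.-1 * (trunc_log 2 q).+1.
  by rewrite card_prod card_ffun !card_ord.
(* From i = 2 on the free entry is number i - 1, because coordinate 1 uses the exponent instead of
   an entry of [p.1]. *)
pose g (p : P) (i : nat) :=
  if i == 0 then co p.1 0 else if i == 1 then co p.1 0 + 2 ^ p.2
  else i * q + co p.1 i.-1.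
have p1_lt (p : P) i : i < r.-1 -> co p.1 i < q by apply: co_lt_n.
have p2_le (p : P) : 2 ^ p.2 <= q.
  apply: leq_trans (trunc_logP (isT : 1 < 2) q0).
  by rewrite leq_exp2l // -ltnS ltn_ord.
have g_lt p i : i < r -> g p i < i.+1 * q.
  case: i => [|[|i]] ir; rewrite /g /=.
  - by rewrite mul1n; apply: p1_lt; lia.
  - by rewrite mul2n -addnn -addSn; apply: leq_add (p2_le p); apply: p1_lt; lia.
  - by rewrite (mulSn i.+2) addnC ltn_add2r; apply: p1_lt; lia.
have g_n p (i : 'I_r) : g p i < n.
  apply: leq_trans (g_lt p i (ltn_ord i)) (leq_trans _ qn).
  by rewrite leq_mul2r ltn_ord orbT.
pose x (p : P) : {ffun 'I_r -> 'I_n} := [ffun i => Ordinal (g_n p i)].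
have xE p i : i < r -> co (x p) i = g p i.
  by move=> ir; rewrite -[i]/(val (Ordinal ir)) coE ffunE.
have xi p : incr (x p).
  apply/incrP => c cr; rewrite xE //; case: (ltnP c.+1 r) => [c1r|rc]; last first.
    have -> : c.+1 = r by lia.
    by rewrite co_last; apply: (g_n p (Ordinal cr)).
  rewrite xE //; case: c cr c1r => [|c] cr c1r.
    by rewrite /g /= -[X in X < _]addn0 ltn_add2l expn_gt0.
  by apply: leq_trans (g_lt p c.+1 cr) _; rewrite [X in _ <= X]/g /= leq_addr.
have x_inj : injective (fun p => edge (x p)).
  move=> p p' /(edge_inj (xi p) (xi p')) Ex.
  have Eg i : i < r -> g p i = g p' i by move=> ir; rewrite -!xE // Ex.
  have E1 : p.1 = p'.1.
    apply: co_inj => -[|i] ir; first by have := Eg 0; rewrite /g /=; apply; lia.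
    have := Eg i.+2; rewrite /g /= => /(_ _)/addnI; apply; lia.
  have E2 : p.2 = p'.2.
    apply: val_inj => /=; apply/eqP; rewrite -(eqn_exp2l _ _ (isT : 1 < 2)).
    by have := Eg 1 r1; rewrite /g /= E1 => /addnI ->.
  by case: p p' E1 E2 {Ex Eg} => [a b] [a' b'] /= -> ->.
rewrite -cardP -(card_imset _ x_inj); apply/subset_leq_card/subsetP => _ /imsetP[p _ ->].
rewrite inE card_edge // eqxx /=.
apply/forallP => w; apply/forallP => u; apply/implyP => /and4P[+ + wu /forall_inP low].
case/imsetP=> i _ Ew /imsetP[j _ Eu].
have r0 : 0 < r by lia.
have lt_x (a b : 'I_r) : a < b -> x p a < x p b.
  by move=> ab; rewrite -!coE; apply: incr_lt; rewrite ?(ltnW (ltn_ord b)).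
have ij : i < j.
  rewrite ltnNge leq_eqVlt; apply/negP => /orP[/eqP/val_inj ji|/lt_x].
    by rewrite Ew Eu ji ltnn in wu.
  by rewrite -Ew -Eu; lia.
have i0 : i = Ordinal r0.
  apply/eqP; apply: contraT => i0; have i_gt0 : Ordinal r0 < i by rewrite lt0n.
  have := low _ (imset_f (x p) (isT : Ordinal r0 \in predT)).
  have := lt_x _ _ i_gt0; have := lt_x _ _ (ltn_trans i_gt0 ij).
  by rewrite -Ew -Eu -!val_eqE /=; lia.
have j1 : j = Ordinal r1.
  apply/eqP; apply: contraT => j1; have j_gt1 : Ordinal r1 < j.
    by move: ij j1; rewrite i0 -val_eqE /=; lia.
  have := low _ (imset_f (x p) (isT : Ordinal r1 \in predT)).
  have i1 : i < Ordinal r1 by rewrite i0.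
  have := lt_x _ _ i1; have := lt_x _ _ j_gt1.
  by rewrite -Ew -Eu -!val_eqE /=; lia.
rewrite Ew Eu i0 j1 !ffunE /= /g /= addnC addnK; exact: is_pow2_exp.
Qed.

Lemma crossing_path_2r_lower r n : 1 < r -> 0 < n %/ r ->
  (n %/ r) ^ r.-1 * (trunc_log 2 (n %/ r)).+1 <= ex_cyc n (crossing_path r (2 * r)).
Proof.
move=> r1 q0; apply: leq_trans (leq_card_pow2_sets r1 q0) _.
apply: uniform_sets_leq_ex_cyc => [e|E' EE']; first by rewrite inE => /andP[/eqP].
exact: pow2_sets_free.
Qed.

(** * Asymptotics *)

(** Every factor n - i with i < r is at least n / 2. *)
Lemma ffact_lower n r : 2 * r <= n -> n ^ r <= 2 ^ r * n ^_ r.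
Proof.
suff h m : m <= r -> 2 * r <= n -> n ^ m <= 2 ^ m * n ^_ m by apply: h.
elim: m => // m IHm mr rn; rewrite ffactnSr !expnSr.
have -> a b c : a * 2 * (b * c) = (a * b) * (2 * c) by lia.
by apply: leq_mul; [apply: IHm; lia | lia].
Qed.

Lemma ex_cyc_lower r : 1 < r -> exists2 K, 0 < K & forall n k, 1 < k -> 2 * r <= n ->
  n ^ r.-1 <= K * ex_cyc n (crossing_path r k).
Proof.
move=> r1; exists (2 ^ r * r`!); first by rewrite muln_gt0 expn_gt0 fact_gt0.
move=> n k k1 rn; have n0 : 0 < n by lia.
rewrite -(leq_pmul2l n0) -expnS prednK; last by lia.
apply: leq_trans (ffact_lower rn) _.
rewrite -bin_ffact (mulnC 'C(n, r)) mulnA (mulnCA n); apply: leq_mul => //.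
apply: leq_trans (crossing_path2_lower (ltnW r1) n0) _.
by apply: leq_mul => //; apply: ex_cyc_crossing_path_leq.
Qed.

Lemma ex_cyc_upper r k : 1 < r -> 0 < k -> k <= 2 * r - 1 ->
  exists2 K, 0 < K & forall n, 0 < n ->
  ex_cyc n (crossing_path r k) <= K * n ^ r.-1.
Proof.
(* The 5 comes from 4n + 1 <= 5n. *)
move=> r1 k0 kr; exists (r * (k * (8 * 5 ^ r.-1))).
  by rewrite !muln_gt0 k0 expn_gt0; lia.
move=> n n0; apply: ex_cyc_leqP => E NE.
apply: leq_trans (leq_card_crossing_free r1 k0 kr NE) _.
rewrite -!mulnA -expnMn; apply: leq_mul => //; apply: leq_mul; first by lia.
by apply: leq_mul => //; rewrite leq_exp2r; lia.
Qed.

Lemma ex_cyc_upper_log r k : 1 < r -> 0 < k ->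
  exists2 K, 0 < K & forall n,
  ex_cyc n (crossing_path r k) <= K * (n ^ r.-1 * (trunc_log 2 n).+1).
Proof.
move=> r1 k0; exists (k * 8); first by lia.
move=> n; apply: ex_cyc_leqP => E NE.
apply: leq_trans (leq_card_crossing_free_log r1 k0 NE) _.
rewrite (mulnC (n ^ _)) !mulnA; apply: leq_mul => //; apply: leq_mul => //; lia.
Qed.

Lemma trunc_log2_mul a b : 0 < a -> 0 < b ->
  trunc_log 2 (a * b) <= trunc_log 2 a + (trunc_log 2 b).+1.
Proof.
move=> a0 b0; rewrite -ltnS -(ltn_exp2l _ _ (isT : 1 < 2)).
have ab : 0 < a * b by rewrite muln_gt0 a0.
apply: leq_ltn_trans (trunc_logP (isT : 1 < 2) ab) _.
rewrite -addSn expnD; apply: ltn_mul; exact: trunc_log_ltn.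
Qed.

Lemma ex_cyc_lower_log r k : 1 < r -> 2 * r <= k ->
  exists2 K, 0 < K & forall n, r <= n ->
  n ^ r.-1 * (trunc_log 2 n).+1 <= K * ex_cyc n (crossing_path r k).
Proof.
(* Since n <= 2r (n %/ r), replacing n %/ r by n costs the first factor in the power and the second
   in the logarithm. *)
move=> r1 rk; pose K := (2 * r) ^ r.-1 * (trunc_log 2 (2 * r)).+2; exists K.
  by rewrite /K !muln_gt0 expn_gt0; lia.
move=> n rn; have q0 : 0 < n %/ r by rewrite divn_gt0 //; lia.
apply: leq_trans (_ : K * ((n %/ r) ^ r.-1 * (trunc_log 2 (n %/ r)).+1) <= _); last first.
  apply: leq_mul => //.
  by apply: leq_trans (crossing_path_2r_lower r1 q0) _; apply: ex_cyc_crossing_path_leq.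
have nq : n <= 2 * r * (n %/ r).
  have := divn_eq n r; have := ltn_pmod n (ltnW r1); nia.
rewrite /K mulnACA; apply: leq_mul.
  by rewrite -expnMn leq_exp2r; lia.
apply: leq_trans (_ : (trunc_log 2 (2 * r * (n %/ r))).+1 <= _).
  by rewrite ltnS; apply: leq_trunc_log.
have r20 : 0 < 2 * r by lia.
by have := trunc_log2_mul r20 q0; nia.
Qed.

Import Order.TTheory GRing.Theory Num.Theory numFieldNormedType.Exports.
Local Open Scope classical_set_scope.
Local Open Scope ring_scope.

Lemma eqTheta_seq (R : realType) (f g : nat -> R) (k1 k2 : R) (N : nat) :
  0 < k1 -> 0 < k2 ->
  (forall n, (N <= n)%N -> 0 <= g n /\ k1 * g n <= f n <= k2 * g n) ->
  f =Theta_\oo g.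
Proof.
move=> k10 k20 fg; rewrite eqThetaE qualifE; apply/asboolP.
exists (k1, k2); first by rewrite /= k10 k20.
exists N => // n /= /fg[g0 /andP[h1 h2]].
have f0 : 0 <= f n by apply: le_trans h1; rewrite mulr_ge0 // ltW.
by rewrite !ger0_norm.
Qed.

Lemma ler_nat_mul (R : realType) (a b K : nat) :
  (0 < K)%N -> (a <= K * b)%N -> K%:R^-1 * a%:R <= b%:R :> R.
Proof. by move=> K0 ab; rewrite ler_pdivrMl ?ltr0n // -natrM ler_nat. Qed.

(** With l the truncated logarithm, 2^l <= n < 2^(l+1), and l >= (l + 1) / 2 because n >= 2 makes l
    positive. *)
Lemma ln_trunc_log2 (R : realType) (n : nat) : (1 < n)%N ->
  ln 2 / 2 * (trunc_log 2 n).+1%:R <= ln (n%:R : R) <= ln 2 * (trunc_log 2 n).+1%:R.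
Proof.
move=> n1; have n0 : (0 < n)%N by apply: ltnW.
have l2 : 0 < ln (2 : R) by rewrite ln_gt0 // ltr1n.
apply/andP; split; last first.
  rewrite mulr_natr -lnXn // ler_ln ?posrE ?exprn_gt0 ?ltr0n //.
  by rewrite -natrX ler_nat ltnW // trunc_log_ltn.
apply: le_trans (_ : ln 2 * (trunc_log 2 n)%:R <= _).
  rewrite -mulrA ler_pM2l // ler_pdivrMl // -natrM ler_nat.
  have : (0 < trunc_log 2 n)%N by rewrite trunc_log_gt0.
  by rewrite mul2n -addnn => h; rewrite -addn1 leq_add2l.
rewrite mulr_natr -lnXn // ler_ln ?posrE ?exprn_gt0 ?ltr0n //.
by rewrite -natrX ler_nat trunc_logP.
Qed.

Theorem theorem2p4 (R : realType) (k r : nat)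
    (hk : (2 <= k)%N) (hr : (2 <= r)%N) :
  [/\ (k <= 2 * r - 1)%N ->
        (fun n : nat => (ex_cyc n (crossing_path r k))%:R : R)
          =Theta_\oo (fun n : nat => n%:R ^+ (r - 1)),
      k = (r + 1)%N ->
        forall n : nat, (2 * r + 1 <= n)%N ->
          ex_cyc n (crossing_path r k) = ('C(n, r) - 'C(n - r, r))%N
    & (2 * r <= k)%N ->
        (fun n : nat => (ex_cyc n (crossing_path r k))%:R : R)
          =Theta_\oo (fun n : nat => n%:R ^+ (r - 1) * ln n%:R)].
Proof.
have k0 : (0 < k)%N by apply: ltnW.
split=> [kr|-> n _|kr].
- have [K1 K10 low] := ex_cyc_lower hr; have [K2 K20 upp] := ex_cyc_upper hr k0 kr.
  apply: (@eqTheta_seq _ _ _ K1%:R^-1 K2%:R (2 * r)); rewrite ?invr_gt0 ?ltr0n //.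
  move=> n rn; have n0 : (0 < n)%N.
    by apply: leq_trans rn; rewrite muln_gt0 /= ltnW.
  rewrite subn1 -natrX ler0n; split=> //.
  by rewrite ler_nat_mul ?low // -natrM ler_nat upp.
- by apply: ex_cyc_crossing_path_exact; apply: ltnW.
have [K1 K10 low] := ex_cyc_lower_log hr kr.
have [K2 K20 upp] := ex_cyc_upper_log hr k0.
have l2 : 0 < ln (2 : R) by rewrite ln_gt0 // ltr1n.
apply: (@eqTheta_seq _ _ _ (K1%:R^-1 / ln 2) (K2%:R * (2 / ln 2)) (2 * r));
  rewrite ?mulr_gt0 ?invr_gt0 ?ltr0n //.
move=> n rn; have n1 : (1 < n)%N.
  by apply: leq_trans rn; apply: leq_trans hr _; rewrite leq_pmull.
have rn' : (r <= n)%N by apply: leq_trans rn; rewrite leq_pmull.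
have /andP[ln_low ln_upp] := @ln_trunc_log2 R n n1.
rewrite subn1 -natrX; split; first by rewrite mulr_ge0 ?ler0n // ln_ge0 // ler1n ltnW.
apply/andP; split.
  apply: le_trans (ler_nat_mul R K10 (low n rn')).
  rewrite -mulrA ler_pM2l ?invr_gt0 ?ltr0n // mulrCA natrM.
  by rewrite ler_wpM2l ?ler0n // ler_pdivrMl.
apply: le_trans (_ : (K2 * (n ^ r.-1 * (trunc_log 2 n).+1))%:R <= _).
  by rewrite ler_nat upp.
rewrite !natrM -mulrA ler_wpM2l ?ler0n // mulrCA ler_wpM2l ?ler0n //.
by rewrite -ler_pdivrMl ?divr_gt0 // invf_div.
Qed.
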